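(* Let $0<\nu\le 1$, $\mu>0$, $n_0\in\mathbb{N}$ with $n_0\ge1$, and let $\{\mathfrak{M}^\nu(t), t>0\}$ be the fractional sublinear death process with death intensity rate $\mu$ and $n_0$ initial individuals. For $k=0,1,\ldots,n_0-1$ let $\mathfrak{T}_k^\nu$ be the random time separating the $k$th and the $(k+1)$th death. Then $\mathfrak{T}_k^\nu$ has probability density function $$\Pr\{\mathfrak{T}_k^\nu\in dt\}/dt=\mu(k+1)\,t^{\nu-1}E_{\nu,\nu}\big(-\mu(k+1)t^\nu\big),\qquad t>0,\quad k=0,1,\ldots,n_0-1 .$$
   Context: The Mittag--Leffler function is $E_{\delta,\beta}(x)=\sum_{j=0}^\infty \frac{x^j}{\Gamma(\delta j+\beta)}$. Fractional sublinear death process: let $\{\mathfrak{M}(t),t\ge 0\}$ be the classical sublinear death process, i.e. the continuous-time Markov chain on $\{0,1,\ldots,n_0\}$ with $\mathfrak{M}(0)=n_0$ that jumps from state $j$ to $j-1$ at rate $\mu(n_0+1-j)$ for $1\le j\le n_0$ (state $0$ is absorbing). For $0<\nu<1$, let $\{S_\nu(x),x\ge 0\}$ be a $\nu$-stable subordinator independent of $\mathfrak{M}$, with $\mathbb{E}e^{-wS_\nu(x)}=e^{-xw^\nu}$, and let $L_\nu(t)=\inf\{x\ge0: S_\nu(x)>t\}$ be its inverse. Then $\mathfrak{M}^\nu(t)=\mathfrak{M}(L_\nu(t))$; for $\nu=1$, $\mathfrak{M}^1(t)=\mathfrak{M}(t)$. The ''$0$th death'' is understood to occur at time $0$, so $\mathfrak{T}_0^\nu$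 is the time of the first death. *)

(* Defs.v *)
From mathcomp Require Export all_boot all_order all_algebra.
From mathcomp Require Export all_classical all_reals all_analysis.
From mathcomp Require Export measurable_realfun.
Export numFieldNormedType.Exports.

Set Implicit Arguments.
Unset Strict Implicit.
Unset Printing Implicit Defensive.
Import Order.TTheory GRing.Theory Num.Theory.
Local Open Scope classical_set_scope.
Local Open Scope ring_scope.

(* Euler's integral; only meaningful for [0 < a]. *)
Definition Gamma (R : realType) (a : R) : R :=
  \int[lebesgue_measure]_(x in `]0%R, +oo[%classic) (x `^ (a - 1) * expR (- x)).

Definition mittag_leffler (R : realType) (delta beta x : R) : R :=
  limn (series (fun j => x ^+ j / Gamma (delta * j%:R + beta))).

(* Stochastic processes indexed by [0, +oo[ are functions [X : R -> T -> E]
   whose values at negative times are never used. *)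

Definition process_sigma_algebra (R : realType) d (T : measurableType d)
    d' (E : measurableType d') (D : set R) (X : R -> T -> E) : set (set T) :=
  <<s \bigcup_(t in D) preimage_set_system [set: T] (X t) measurable >>.

Definition independent_systems (R : realType) d (T : measurableType d)
    (P : probability T R) (G H : set (set T)) : Prop :=
  forall A B, G A -> H B -> P (A `&` B) = (P A * P B)%E.

Definition measurable_process (R : realType) d (T : measurableType d)
    d' (E : measurableType d') (X : R -> T -> E) : Prop :=
  forall t : R, 0 <= t -> measurable_fun [set: T] (X t).

Definition right_continuous_paths (R : realType) (T : Type)
    (E : topologicalType) (X : R -> T -> E) : Prop :=
  forall w (t : R), 0 <= t -> X s w @[s --> t^'+] --> X t w.

(* Indexed by the states {0, ..., n}. *)
Definition transition_function (R : realType) (n : nat) (p : R -> 'M[R]_n.+1)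
    : Prop :=
  [/\ forall t, 0 <= t -> forall i j, 0 <= p t i j,
      forall t, 0 <= t -> forall i, \sum_j p t i j = 1,
      p 0 = 1%:M
    & forall s t, 0 <= s -> 0 <= t -> p (s + t) = p s *m p t].

(* [p h i j = (i == j) + q i j * h + o(h)] as [h] decreases to 0. *)
Definition has_rates (R : realType) (n : nat) (p : R -> 'M[R]_n.+1)
    (q : 'M[R]_n.+1) : Prop :=
  forall i j, (p h i j - (i == j)%:R) / h @[h --> 0^'+] --> q i j.

(* Right-continuous time-homogeneous Markov chain on {0, ..., n} with rate
   matrix [q]. The Markov property with respect to the natural filtration is
   multiplied out to avoid conditioning on null events. *)
Definition markov_chain (R : realType) d (T : measurableType d)
    (P : probability T R) (n : nat) (q : 'M[R]_n.+1) (X : R -> T -> nat)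
    : Prop :=
  [/\ measurable_process X,
      forall (t : R) w, 0 <= t -> (X t w <= n)%N,
      right_continuous_paths X
    & exists p : R -> 'M[R]_n.+1,
      [/\ transition_function p, has_rates p q
        & forall (s t : R) (A : set T) (i j : 'I_n.+1), 0 <= s -> 0 <= t ->
            process_sigma_algebra `[0, s]%classic X A ->
            P (A `&` [set w | X s w = i] `&` [set w | X (s + t) w = j]) =
            (P (A `&` [set w | X s w = i]) * (p t i j)%:E)%E]].

Definition sublinear_death_rate (R : realType) (mu : R) (n0 j : nat) : R :=
  if j == 0%N then 0 else mu * (n0 + 1 - j)%N%:R.

Definition sublinear_death_generator (R : realType) (mu : R) (n0 : nat)
    : 'M[R]_n0.+1 :=
  \matrix_(i, j) (sublinear_death_rate mu n0 i *
                  ((j.+1 == i :> nat)%:R - (j == i)%:R)).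

Definition sublinear_death_process (R : realType) d (T : measurableType d)
    (P : probability T R) (mu : R) (n0 : nat) (M : R -> T -> nat) : Prop :=
  markov_chain P (sublinear_death_generator mu n0) M /\
  (forall w, M 0 w = n0).

(* The paths are cadlag: left limits exist by monotonicity. *)
Definition subordinator (R : realType) d (T : measurableType d)
    (P : probability T R) (S : R -> T -> R) : Prop :=
  [/\ measurable_process S,
      [/\ forall w, S 0 w = 0,
          forall w (s t : R), 0 <= s -> s <= t -> S s w <= S t w
        & right_continuous_paths S],
      forall (s t : R) (A : set R), 0 <= s -> 0 <= t -> measurable A ->
        P [set w | A (S (s + t) w - S s w)] = P (S t @^-1` A)
    & forall s t : R, 0 <= s -> 0 <= t ->
        independent_systems P (process_sigma_algebra `[0, s]%classic S)
          (preimage_set_system [set: T] (fun w => S (s + t) w - S s w)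
             measurable)].

Definition stable_subordinator (R : realType) d (T : measurableType d)
    (P : probability T R) (nu : R) (S : R -> T -> R) : Prop :=
  subordinator P S /\
  forall w x : R, 0 <= w -> 0 <= x ->
    ('E_P[fun o => expR (- w * S x o)] = (expR (- x * w `^ nu))%:E)%E.

(* [inf set0 = 0]: a convention used only on the null event that the path of
   [S] is bounded. *)
Definition inverse_process (R : realType) (T : Type) (S : R -> T -> R)
    (t : R) (w : T) : R :=
  inf [set x | 0 <= x /\ t < S x w].

Definition fractional_sublinear_death_process (R : realType) d
    (T : measurableType d) (P : probability T R) (nu mu : R) (n0 : nat)
    (X : R -> T -> nat) : Prop :=
  exists2 M : R -> T -> nat, sublinear_death_process P mu n0 M &
    if nu == 1 then forall t w, 0 <= t -> X t w = M t w
    else exists S : R -> T -> R,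
      [/\ stable_subordinator P nu S,
          independent_systems P
            (process_sigma_algebra `[0, +oo[%classic M)
            (process_sigma_algebra `[0, +oo[%classic S)
        & forall t w, 0 <= t -> X t w = M (inverse_process S t w) w].

(* Time of the [k]-th death; +oo if fewer than [k] deaths ever occur, and 0 for
   [k = 0]. *)
Definition death_time (R : realType) (T : Type) (n0 : nat) (X : R -> T -> nat)
    (k : nat) (w : T) : \bar R :=
  ereal_inf [set t%:E | t in [set t : R | 0 <= t /\ (k <= n0 - X t w)%N]].

Definition interdeath_time (R : realType) (T : Type) (n0 : nat)
    (X : R -> T -> nat) (k : nat) (w : T) : \bar R :=
  (death_time n0 X k.+1 w - death_time n0 X k w)%E.

(* [B] ranges over Borel sets of the extended line, so that in particular [Y]
   is almost surely finite. *)
Definition has_pdf (R : realType) d (T : measurableType d)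
    (P : probability T R) (Y : T -> \bar R) (f : R -> R) : Prop :=
  [/\ measurable_fun [set: T] Y,
      measurable_fun [set: R] f,
      forall x, 0 <= f x
    & forall B : set (\bar R), measurable B ->
        P (Y @^-1` B) =
        (\int[lebesgue_measure]_(x in EFin @^-1` B) (f x)%:E)%E].

(* Main.v *)
(* Let [S] be the subordinator ([S x = x] if [nu = 1]), [sigma_k] the time of the
   [k]-th death in the chain [M], and [L] the inverse of [S]. The path of [M] at
   [L t] drops below the level [n0 - k + 1] exactly when [L t] reaches [sigma_k],
   so the [k]-th death of the time-changed process occurs at the left limit of
   [S] at [sigma_k], which is the limit of [S] along dyadic times increasing to
   [sigma_k]. These dyadic times take countably many values and are determined
   by [M], which is independent of [S], so with [Y] the interdeath time and [w > 0]
     E exp (- w Y) = E exp (- w^nu (sigma_(k+1) - sigma_k)).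
   Here [sigma_(k+1) - sigma_k] is the holding time of [M] in [n0 - k], which is
   exponential of parameter [lam = mu (k+1)]: on the dyadic grids the Markov
   property and [p_t(i,i) = exp (- t lam)] give the tail, and no state is skipped
   since a transition with rate 0 has probability [o(h)] on a grid of step [h].
   Thus [Y] has Laplace transform [lam / (lam + w^nu)]. Integrating the
   Mittag-Leffler series term by term, the claimed density has the same
   transform for all large [w], and an inversion formula using only these [w]
   identifies the two laws. *)
From HB Require Import structures.
From mathcomp Require Import ring lra zify.
Require Import Defs.
Set Implicit Arguments.
Unset Strict Implicit.
Unset Printing Implicit Defensive.
Import Order.TTheory GRing.Theory Num.Theory.
Local Open Scope classical_set_scope.
Local Open Scope ring_scope.

(** * Gamma integrals and the Mittag-Leffler density *)

(** Three obstacles shape the proof. The sign of the density, which [has_pdf] asks for, cannot be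
    read off its alternating series; the inversion must therefore allow signed weights, and its
    dominated convergence rests on a bound linear in [expR (- (s * t))]. The sign is recovered
    afterwards: a continuous function whose integrals over []0, c]] form a distribution function
    cannot be negative anywhere. Next, the Markov property concerns fixed times and probabilities,
    whereas deaths happen at random times of individual paths; monotonicity, the visit to each state
    and the descent to each level are thus obtained almost surely from countably many events on
    dyadic grids, and transferred to all times because a path is constant for a while to the right
    of each time. Finally, independence is given for events only, and is turned into identities
    between integrals by the tail formula. The time change is treated for an abstract [S]
    constrained by the transform of its increments, so that the stable subordinator and the identity
    are two instances of one argument. *)

Section scaling.
Context {R : realType}.
Local Notation leb := (@lebesgue_measure R).

Lemma lebesgue_measure_scale (w : {nonneg R}) (A : set R) :
  0 < w%:num -> measurable A ->
  leb A = (w%:num%:E * leb ( *%R w%:num @^-1` A))%E.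
Proof.
move=> w0 mA.
have mw : measurable_fun [set: measurableTypeR R]
    (fun x => w%:num * x : measurableTypeR R) by exact: measurable_funM.
apply: (@lebesgue_measure_unique R (mscale w (pushforward leb
  (fun x : measurableTypeR R => w%:num * x : measurableTypeR R)))) => //=.
move=> _ [[a b]] _ <-; rewrite /mscale /pushforward /=.
pose c := a / w%:num; pose e := b / w%:num.
transitivity (w%:num%:E * leb `]c, e]%classic)%E.
  rewrite !lebesgue_measure_itv/= !lte_fin ltr_pM2r ?invr_gt0//.
  case: ifPn => _; last by rewrite mule0.
  by rewrite -!EFinB -EFinM mulrBr !(mulrC w%:num) !divfK ?gt_eqF.
congr (_ * leb _)%E; apply/seteqP; split => x /=; rewrite !in_itv/=;
  by rewrite ltr_pdivrMr// ler_pdivlMr// mulrC.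
Qed.

Lemma ge0_integral_scale (w : R) (f : R -> R) : 0 < w ->
  measurable_fun (`]0, +oo[%classic : set R) f ->
  (forall x, 0 < x -> 0 <= f x) ->
  (\int[leb]_(x in `]0%R, +oo[) (f x)%:E =
   w%:E * \int[leb]_(x in `]0%R, +oo[) (f (w * x))%:E)%E.
Proof.
move=> w0 mf f0; pose w' := NngNum (ltW w0).
have mw : measurable_fun [set: measurableTypeR R]
    (fun x => w * x : measurableTypeR R) by exact: measurable_funM.
have mEf : measurable_fun (`]0, +oo[%classic : set R) (EFin \o f) by exact/measurable_EFinP.
rewrite (@eq_measure_integral _ _ _ _ (mscale w' (pushforward leb
  (fun x : measurableTypeR R => w * x : measurableTypeR R)))) //=.
  rewrite ge0_integral_mscale//=; last first.
    by move=> x; rewrite in_itv/= andbT lee_fin => /f0.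
  congr (_ * _)%E; rewrite ge0_integral_pushforward//=; last first.
    by move=> x; rewrite inE/= in_itv/= andbT lee_fin => /f0.
  congr (integral _ _ _); apply/seteqP; split => x /=; rewrite !in_itv/= !andbT.
    by rewrite pmulr_rgt0.
  by move=> x0; rewrite mulr_gt0.
by move=> A mA _; apply: lebesgue_measure_scale.
Qed.

End scaling.

Section gamma.
Context {R : realType}.
Local Notation leb := (@lebesgue_measure R).
Implicit Types (a w : R).

Lemma continuous_powR a (x : R) : 0 < x -> {for x, continuous (@powR R ^~ a)}.
Proof.
move=> x0; apply: differentiable_continuous; apply/derivable1_diffP.
by apply: derivable_powR; rewrite in_itv/= x0.
Qed.

Lemma measurable_powR_expR a w (D : set R) :
  measurable_fun D (fun x => x `^ (a - 1) * expR (- (w * x))).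
Proof.
apply: measurable_funTS; apply: measurable_funM; first exact: measurable_powR.
by apply: measurableT_comp => //; apply: measurableT_comp => //; exact: measurable_funM.
Qed.

Lemma measurable_gamma_integrand a (D : set R) :
  measurable_fun D (fun x => x `^ (a - 1) * expR (- x)).
Proof.
apply: measurable_funTS; apply: measurable_funM; first exact: measurable_powR.
exact: measurableT_comp.
Qed.

Lemma powR_expR_ge0 a w (x : R) : 0 <= x `^ (a - 1) * expR (- (w * x)).
Proof. by rewrite mulr_ge0 ?powR_ge0 ?expR_ge0. Qed.

(** The integrand may blow up at 0, so the primitive [x ^ a / a] is used on the intervals
    [[1 / (n + 2), 1]], which exhaust []0, 1]]. *)
Lemma integral_powR01 a : 0 < a ->
  (\int[leb]_(x in `]0%R, 1%R]) (x `^ (a - 1))%:E <= a^-1%:E)%E.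
Proof.
move=> a0; pose F (n : nat) : set R := `[n.+2%:R^-1, 1]%classic.
have F0 n x : F n x -> 0 < x.
  by rewrite /F/= in_itv/= => /andP[+ _]; apply: lt_le_trans; rewrite invr_gt0.
have mf (D : set R) : measurable_fun D (fun x => (x `^ (a - 1))%:E).
  by apply/measurable_EFinP/measurable_funTS; exact: measurable_powR.
have -> : `]0, 1]%classic = \bigcup_i F i.
  apply/seteqP; split => [x /=|x [n _ Fnx]]; last first.
    have := Fnx; rewrite /F /= !in_itv/= => /andP[_ ->].
    by rewrite (F0 _ _ Fnx).
  rewrite in_itv/= => /andP[x0 x1]; exists (Num.bound x^-1) => //.
  rewrite /F/= in_itv/= x1 andbT invf_ple ?posrE//.
  apply: ltW; apply: (lt_le_trans (archi_boundP _)); first by rewrite invr_ge0 ltW.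
  by rewrite ler_nat; apply: (leq_trans (leqnSn _)).
have h : (\int[leb]_(x in F i) (x `^ (a - 1))%:E @[i --> \oo] -->
    \int[leb]_(x in \bigcup_i F i) (x `^ (a - 1))%:E)%E.
  apply: ge0_nondecreasing_set_cvg_integral => //.
  - apply/nondecreasing_seqP => n; apply/subsetPset; apply: subset_itvr.
    by rewrite bnd_simp lef_pV2 ?posrE// ler_nat.
  - by move=> i; exact: measurable_itv.
  - by move=> i; exact: mf.
  - by move=> i x _; rewrite lee_fin powR_ge0.
rewrite -(cvg_lim _ h)//; apply: lime_le; first by apply/cvg_ex; eexists; exact: h.
apply: nearW => n; pose b : R := n.+2%:R^-1.
have b0 : 0 < b by rewrite invr_gt0.
have b1 : b < 1 by rewrite invf_lt1// ltr1n.
rewrite (@continuous_FTC2 _ _ (fun x => a^-1 * x `^ a))//.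
- by rewrite -EFinB lee_fin powR1 mulr1 lerBlDr lerDl mulr_ge0 ?powR_ge0// invr_ge0 ltW.
- apply: continuous_in_subspaceT => x /set_mem/F0; exact: continuous_powR.
- have c x : 0 < x -> {for x, continuous (fun x => a^-1 * x `^ a)}.
    move=> x0; apply: (@continuousM _ R^o (fun=> a^-1) (@powR R ^~ a)).
      exact: cst_continuous.
    exact: continuous_powR.
  split.
  + move=> x; rewrite in_itv/= => /andP[bx _]; apply: derivableM => //.
    by apply: derivable_powR; rewrite in_itv/= (lt_trans b0).
  + by apply: cvg_at_right_filter; exact: c.
  + by apply: cvg_at_left_filter; exact: c.
- move=> x; rewrite in_itv/= => /andP[bx _].
  have x0 : 0 < x by rewrite (lt_trans b0).
  rewrite derive1Ml; last by apply: derivable_powR; rewrite in_itv/= x0.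
  rewrite powR_derive1 ?in_itv/= ?x0//.
  by rewrite mulrA mulVf ?gt_eqF// mul1r.
Qed.

(** Up to 1 the exponential is at most 1. Beyond 1, half of the exponent absorbs the power through
    [x ^ n <= n! 2 ^ n expR (x / 2)], which leaves a multiple of the exponential density of rate
    [1 / 2]. *)
Lemma integral_gamma_lty a : 0 < a ->
  (\int[leb]_(x in `]0%R, +oo[) (x `^ (a - 1) * expR (- x))%:E < +oo)%E.
Proof.
move=> a0; pose n := (Num.bound a).+1.
have mg (D : set R) : measurable_fun D (fun x => (x `^ (a - 1) * expR (- x))%:E).
  apply/measurable_EFinP; exact: measurable_gamma_integrand.
have me (D : set R) : measurable_fun D (fun x : R => expR (- 2^-1 * x)).
  by apply: measurable_funTS; apply: measurableT_comp => //; exact: measurable_funM.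
have -> : `]0, +oo[%classic = `]0, 1]%classic `|` `]1, +oo[%classic :> set R.
  by rewrite -itv_bndbnd_setU ?bnd_simp.
rewrite ge0_integral_setU//=; last 3 first.
- exact: mg.
- by move=> x _; rewrite lee_fin mulr_ge0 ?powR_ge0 ?expR_ge0.
- apply/disj_setPS => x [] /=; rewrite !in_itv/= andbT => /andP[_ x1].
  by rewrite ltNge x1.
apply: lte_add_pinfty.
  apply: (@le_lt_trans _ _ a^-1%:E); last exact: ltry.
  apply: (le_trans _ (integral_powR01 a0)).
  apply: ge0_le_integral => //.
  - by move=> x _; rewrite lee_fin mulr_ge0 ?powR_ge0 ?expR_ge0.
  - exact: mg.
  - by apply/measurable_EFinP/measurable_funTS; exact: measurable_powR.
  move=> x /=; rewrite in_itv/= => /andP[x0 _]; rewrite lee_fin ler_piMr ?powR_ge0//.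
  by rewrite -expR0 ler_expR oppr_le0 ltW.
pose C : R := n`!%:R * 2 ^+ n.
have C0 : 0 <= C by rewrite mulr_ge0// exprn_ge0.
have half0 : 0 < 2^-1 :> R by rewrite invr_gt0.
have C20 : 0 <= C * 2 by rewrite mulr_ge0.
have e0 x : 0 <= exponential_pdf (2^-1 : R) x by rewrite exponential_pdf_ge0// ltW.
apply: (@le_lt_trans _ _
  (\int[leb]_x ((C * 2)%:E * (exponential_pdf 2^-1 x)%:E))%E).
  apply: (@le_trans _ _
    (\int[leb]_(x in `]1%R, +oo[) ((C * 2)%:E * (exponential_pdf 2^-1 x)%:E))%E).
    apply: ge0_le_integral => //.
    + by move=> x _; rewrite lee_fin mulr_ge0 ?powR_ge0 ?expR_ge0.
    + exact: mg.
    + apply/measurable_EFinP; apply: measurable_funM => //.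
      exact: measurable_funTS (measurable_exponential_pdf _).
    move=> x /=; rewrite in_itv/= andbT => x1.
    have x0 : 0 < x by rewrite (lt_trans _ x1).
    rewrite lee_fin exponential_pdfE ?(ltW x0)// mulrA mulfK//.
    rewrite [in leLHS](_ : - x = - 2^-1 * x + - 2^-1 * x); last by field.
    rewrite expRD mulrA ler_wpM2r ?expR_ge0// mulNr expRN ler_pdivrMr ?expR_gt0//.
    apply: (@le_trans _ _ (x ^+ n)).
      rewrite -powR_mulrn ?(ltW x0)//; apply: ler_powR; first exact: ltW.
      rewrite lerBlDr; apply: ltW; apply: (lt_le_trans (archi_boundP (ltW a0))).
      by rewrite natr1 ler_nat /n ltnW// ltnW.
    have := @expR_ge1Dxn R (2^-1 * x) n.-1 (mulr_ge0 (ltW half0) (ltW x0)).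
    rewrite prednK// => h; rewrite /C -mulrA mulrC.
    rewrite -ler_pdivrMr ?ltr0n ?fact_gt0// -ler_pdivrMl ?exprn_gt0//.
    apply: le_trans h; rewrite exprMn -exprVn mulrA ler_wpDl//.
  apply: ge0_subset_integral => //=.
  - apply/measurable_EFinP; apply: measurable_funM => //.
    exact: measurable_funTS (measurable_exponential_pdf _).
  - by move=> x _; apply: mule_ge0; rewrite lee_fin.
rewrite ge0_integralZl//=; first by rewrite integral_exponential_pdf// mule1 ltry.
  apply/measurable_EFinP; exact: (measurable_exponential_pdf (2^-1 : R)).
by move=> x _; rewrite lee_fin.
Qed.

Lemma integral_gamma a : 0 < a ->
  (\int[leb]_(x in `]0%R, +oo[) (x `^ (a - 1) * expR (- x))%:E = (Gamma a)%:E)%E.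
Proof.
move=> a0; rewrite /Gamma /Rintegral fineK// ge0_fin_numE ?integral_gamma_lty//.
by apply: integral_ge0 => x _; rewrite lee_fin mulr_ge0 ?powR_ge0 ?expR_ge0.
Qed.

(** Laplace transform of a power, to be applied to each term of the Mittag-Leffler series. *)
Lemma integral_gamma_scale a w : 0 < a -> 0 < w ->
  (\int[leb]_(x in `]0%R, +oo[) (x `^ (a - 1) * expR (- (w * x)))%:E =
   (Gamma a * w `^ (- a))%:E)%E.
Proof.
move=> a0 w0.
have mg : measurable_fun (`]0, +oo[%classic : set R)
    (fun x : R => x `^ (a - 1) * expR (- x)).
  exact: measurable_gamma_integrand.
have g0 (x : R) : 0 < x -> 0 <= x `^ (a - 1) * expR (- x).
  by move=> _; rewrite mulr_ge0 ?powR_ge0 ?expR_ge0.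
have := ge0_integral_scale w0 mg g0; rewrite integral_gamma//.
have -> : (\int[leb]_(x in `]0%R, +oo[) ((w * x) `^ (a - 1) * expR (- (w * x)))%:E =
   (w `^ (a - 1))%:E * \int[leb]_(x in `]0%R, +oo[) (x `^ (a - 1) * expR (- (w * x)))%:E)%E.
  rewrite -ge0_integralZl//=.
  - apply: eq_integral => x; rewrite inE/= in_itv/= andbT => x0.
    by rewrite powRM ?ltW// -mulrA EFinM.
  - by apply/measurable_EFinP; exact: measurable_powR_expR.
  - by move=> x _; rewrite lee_fin powR_expR_ge0.
  - by rewrite lee_fin powR_ge0.
rewrite muleA -EFinM mulr_powRB1 ?ltW// => /(congr1 (fun z => (w `^ (- a))%:E * z)%E).
rewrite powRN [RHS]muleA -!EFinM mulVf ?mul1e; last by rewrite gt_eqF// powR_gt0.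
by move=> <-; rewrite mulrC.
Qed.

Lemma integrable_gamma_scale a w : 0 < a -> 0 < w ->
  leb.-integrable `]0%R, +oo[ (fun x => (x `^ (a - 1) * expR (- (w * x)))%:E).
Proof.
move=> a0 w0; apply/integrableP; split.
  by apply/measurable_EFinP; exact: measurable_powR_expR.
under eq_integral do rewrite /= ger0_norm ?powR_expR_ge0//.
by rewrite integral_gamma_scale// ltry.
Qed.

(** Only [[K, 2 K]] is kept of the integral; there the power is at least [K ^ (a - 1) / 2], the
    factor [1 / 2] covering the case [a < 1]. As [K] is free, Gamma outgrows every exponential. *)
Lemma Gamma_ge a (K : R) : 0 < a -> 0 < K ->
  K `^ a * (expR (- (2 * K)) / 2) <= Gamma a.
Proof.
move=> a0 K0; rewrite -lee_fin -integral_gamma//.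
have mg (D : set R) : measurable_fun D (fun x => (x `^ (a - 1) * expR (- x))%:E).
  apply/measurable_EFinP; exact: measurable_gamma_integrand.
have K2 : K < 2 * K by rewrite mulr_natl mulr2n ltrDl.
pose c := K `^ (a - 1) * (expR (- (2 * K)) / 2).
apply: (@le_trans _ _ (\int[leb]_(x in `[K, (2 * K)%R]) (cst c%:E x))%E).
  rewrite integral_cst//= lebesgue_measure_itv/= lte_fin K2 -EFinB -EFinM lee_fin.
  rewrite /c (_ : 2 * K - K = K); last by rewrite mulr_natl mulr2n addrK.
  by rewrite [leRHS]mulrC [leRHS]mulrA mulr_powRB1// ltW.
apply: (@le_trans _ _
   (\int[leb]_(x in `[K, (2 * K)%R]) (x `^ (a - 1) * expR (- x))%:E)%E).
  apply: ge0_le_integral => //.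
  - by move=> x _; rewrite lee_fin /c mulr_ge0 ?powR_ge0// mulr_ge0// expR_ge0.
  - exact: mg.
  move=> x /=; rewrite in_itv/= => /andP[Kx xK]; rewrite lee_fin /c.
  have x0 : 0 < x by rewrite (lt_le_trans K0).
  rewrite mulrCA [leRHS]mulrC ler_pM ?expR_ge0 ?divr_ge0 ?powR_ge0//.
    by rewrite ler_expR lerN2.
  rewrite ler_pdivrMr//.
  have [a1|a1] := leP 1 a.
    apply: (@le_trans _ _ (x `^ (a - 1))).
      by rewrite ge0_ler_powR// ?subr_ge0// nnegrE ltW.
    by rewrite ler_peMr ?powR_ge0// ler1n.
  apply: (@le_trans _ _ ((2 * K) `^ (a - 1) * 2)).
    rewrite powRM ?(ltW K0)// mulrAC ler_peMl ?powR_ge0//.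
    rewrite mulrC mulr_powRB1//; apply: le_trans (_ : 2 `^ 0 <= _).
      by rewrite powRr0.
    by rewrite ler_powR ?ler1n// ltW.
  rewrite ler_wpM2r//.
  rewrite -[a - 1]opprB !powRN lef_pV2 ?posrE ?powR_gt0 ?mulr_gt0//.
  by rewrite ge0_ler_powR ?subr_ge0 ?nnegrE ?(ltW a1) ?(ltW x0)// mulr_ge0// ltW.
apply: ge0_subset_integral => //=; first exact: mg.
- by move=> x _; rewrite lee_fin mulr_ge0 ?powR_ge0 ?expR_ge0.
- by move=> x /=; rewrite !in_itv/= andbT => /andP[Kx _]; exact: lt_le_trans Kx.
Qed.

Lemma Gamma_gt0 a : 0 < a -> 0 < Gamma a.
Proof.
move=> a0; apply: lt_le_trans (Gamma_ge a0 ltr01).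
by rewrite powR1 mul1r divr_gt0// expR_gt0.
Qed.

End gamma.

(** * Entire power series and the Mittag-Leffler density *)

Section entire.
Context {R : realType}.
Implicit Types (c : nat -> R) (x y : R).

(* The power series with coefficients [c] has infinite radius of convergence. *)
Definition entire_coef c :=
  forall x, 0 <= x -> exists C : R, forall j, `|c j| * x ^+ j <= C.

(** The new factor [j + 1] is at most [2 ^ (j + 1)], absorbed by the radius [2 x + 1], whose [+ 1]
    makes the surplus power at least 1. Continuity of the sum will use this twice, for two derived
    series. *)
Lemma entire_coef_diffs c : entire_coef c -> entire_coef (pseries_diffs c).
Proof.
move=> ec x x0; have [|C hC] := ec (2 * x + 1); first by rewrite addr_ge0// mulr_ge0.
exists (2 * C) => j; apply: le_trans (_ : 2 * (`|c j.+1| * (2 * x + 1) ^+ j.+1) <= _).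
  rewrite /pseries_diffs normrM -mulrA [leLHS]mulrCA [leRHS]mulrCA.
  rewrite ler_wpM2l// ger0_norm//.
  apply: (@le_trans _ _ (2 ^+ j.+1 * x ^+ j)).
    by rewrite ler_wpM2r ?exprn_ge0// -natrX ler_nat ltnW// ltn_expl.
  rewrite exprS -mulrA ler_wpM2l// -exprMn.
  apply: (@le_trans _ _ ((2 * x + 1) ^+ j)).
    by rewrite lerXn2r ?nnegrE ?addr_ge0 ?mulr_ge0// lerDl.
  by rewrite exprS ler_peMl ?exprn_ge0 ?addr_ge0 ?mulr_ge0// lerDr mulr_ge0.
by rewrite ler_wpM2l.
Qed.

Lemma is_cvg_entire_norm c x : entire_coef c ->
  cvgn (series (fun j => `|c j| * `|x| ^+ j)).
Proof.
move=> ec; have [|C hC] := ec (2 * `|x|); first by rewrite mulr_ge0.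
apply: (@series_le_cvg _ _ (geometric C 2^-1)).
- by move=> n; rewrite mulr_ge0// exprn_ge0.
- move=> n; rewrite mulr_ge0 ?exprn_ge0//.
  by apply: le_trans (hC 0%N); rewrite mulr_ge0.
- move=> n; rewrite /geometric/= exprVn ler_pdivlMr ?exprn_gt0//.
  by rewrite -mulrA -exprMn [`|x| * _]mulrC.
- by apply: is_cvg_geometric_series; rewrite ger0_norm// invf_lt1// ltr1n.
Qed.

Lemma is_cvg_entire c x : entire_coef c -> cvgn (pseries c x).
Proof.
move=> ec; apply: normed_cvg; rewrite /pseries.
have := @is_cvg_entire_norm c x ec.
by under eq_fun do rewrite -normrX -normrM.
Qed.

Lemma continuous_entire c : entire_coef c ->
  continuous (fun x => limn (pseries c x)).
Proof.
move=> ec x; apply: differentiable_continuous; apply/derivable1_diffP.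
have ed := entire_coef_diffs ec; have edd := entire_coef_diffs ed.
have := @pseries_snd_diffs R c (`|x| + 1) x (is_cvg_entire ec)
  (is_cvg_entire ed) (is_cvg_entire edd).
have h : `|x| < `| (`|x| + 1) | by rewrite [ltRHS]ger0_norm ?addr_ge0// ltrDl.
by move=> /(_ h) [].
Qed.

End entire.

Section integral_of_series.
Context d (T : measurableType d) (R : realType) (mu : {measure set T -> \bar R}).

(** The sum of the absolute values dominates all partial sums; by monotone convergence its integral
    is at most the sum of [b]. *)
Lemma integral_series (D : set T) (u : nat -> T -> R) (F : T -> R) (b : nat -> R) :
  measurable D ->
  (forall j, mu.-integrable D (EFin \o u j)) ->
  measurable_fun D F ->
  (forall x, D x -> series (u ^~ x) n @[n --> \oo] --> F x) ->
  (forall j, \int[mu]_(x in D) `|(u j x)%:E| <= (b j)%:E)%E ->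
  cvgn (series b) ->
  mu.-integrable D (EFin \o F) /\
  (\sum_(0 <= j < n) \int[mu]_(x in D) (u j x)%:E)%E @[n --> \oo]
    --> (\int[mu]_(x in D) (F x)%:E)%E.
Proof.
move=> mD iu mF uF ub cb.
have b0 j : 0 <= b j.
  by rewrite -lee_fin; apply: le_trans (ub j); exact: integral_ge0.
have mu_ j : measurable_fun D (fun x => (u j x)%:E) := measurable_int _ (iu j).
pose g x := (\sum_(j <oo) `|(u j x)%:E|)%E.
have mg : measurable_fun D g.
  apply: (@ge0_emeasurable_sum _ _ _ D (fun j x => `|(u j x)%:E|)%E xpredT) => //.
  by move=> k _; exact: measurableT_comp.
have g0 x : (0 <= g x)%E by apply: nneseries_ge0 => *.
have ig : mu.-integrable D g.
  apply/integrableP; split => //.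
  under eq_integral do rewrite gee0_abs//.
  rewrite integral_nneseries//; last first.
    by move=> k; exact: measurableT_comp.
  apply: (@le_lt_trans _ _ (\sum_(j <oo) (b j)%:E)%E).
    by apply: lee_nneseries => // j *; exact: integral_ge0.
  have -> : (\sum_(j <oo) (b j)%:E)%E = (limn (series b))%:E.
    apply/cvg_lim => //.
    rewrite (_ : (fun n => _) = EFin \o series b); last first.
      by apply/funext => n /=; rewrite sumEFin.
    by apply: cvg_EFin => //; exact: nearW.
  exact: ltry.
have mEF : measurable_fun D (fun x => (F x)%:E) by exact/measurable_EFinP.
have [] := @dominated_convergence _ T R mu D mD
  (fun n x => \sum_(0 <= j < n) (u j x)%:E)%E (fun x => (F x)%:E) g.
- by move=> n; exact: emeasurable_sum.
- by [].
- apply: aeW => x Dx /=.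
  rewrite (_ : (fun n => _) = EFin \o series (u ^~ x)); last first.
    by apply/funext => n /=; rewrite sumEFin.
  by apply: cvg_EFin; [exact: nearW|exact: uF].
- exact: ig.
- apply: aeW => x n Dx; apply: le_trans (lee_abs_sum _ _ _) _.
  by apply: nneseries_lim_ge.
move=> iF _ h; split; first exact: iF.
rewrite [X in X @ \oo --> _](_ : _ = (fun n => \int[mu]_(x in D)
  (\sum_(0 <= j < n) (u j x)%:E)%E)%E); first exact: h.
by apply/funext => n; rewrite integral_sum.
Qed.

End integral_of_series.

Section mittag_leffler_function.
Context {R : realType}.
Local Notation leb := (@lebesgue_measure R).
Variables (nu : R) (nu0 : 0 < nu).

Let c j : R := (Gamma (nu * j%:R + nu))^-1.

Let arg_gt0 j : 0 < nu * j%:R + nu.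
Proof. by rewrite ltr_wpDl// mulr_ge0// ltW. Qed.

Let c_gt0 j : 0 < c j.
Proof. by rewrite invr_gt0 Gamma_gt0. Qed.

(** [K] is chosen with [K ^ nu = x + 1], so that [Gamma_ge] bounds the [j]-th Gamma value below by a
    constant times [(x + 1) ^ (j + 1)]. *)
Lemma entire_coef_mittag_leffler : entire_coef c.
Proof.
move=> x x0; pose K : R := (x + 1) `^ (nu^-1).
have x10 : 0 < x + 1 by rewrite ltr_wpDl.
have K0 : 0 < K by rewrite powR_gt0.
have Knu : K `^ nu = x + 1 by rewrite -powRrM mulVf ?gt_eqF// powRr1// ltW.
have e0 : 0 < expR (- (2 * K)) / 2 by rewrite divr_gt0// expR_gt0.
exists (expR (- (2 * K)) / 2)^-1 => j.
rewrite ger0_norm ?(ltW (c_gt0 _))//.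
have h := Gamma_ge (arg_gt0 j) K0.
rewrite /c mulrC ler_pdivrMr ?Gamma_gt0// mulrC -ler_pdivrMr ?invr_gt0// invrK.
apply: le_trans h; rewrite ler_wpM2r ?(ltW e0)//.
rewrite powRD; last by rewrite (gt_eqF K0) implybT.
rewrite powRrM Knu powR_mulrn ?(ltW x10)//.
apply: (@le_trans _ _ ((x + 1) ^+ j)).
  by rewrite lerXn2r ?nnegrE ?(ltW x10)// lerDl.
by rewrite ler_peMr ?exprn_ge0 ?(ltW x10)// lerDr.
Qed.

Let mlE x : mittag_leffler nu nu x = limn (pseries c x).
Proof.
rewrite /mittag_leffler /pseries; congr (limn (series _)).
by apply/funext => j; rewrite mulrC.
Qed.

Lemma continuous_mittag_leffler : continuous (mittag_leffler nu nu).
Proof.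
have -> : mittag_leffler nu nu = fun x => limn (pseries c x) by apply/funext.
exact/continuous_entire/entire_coef_mittag_leffler.
Qed.

Variables (lam : R) (lam0 : 0 < lam).

Definition ml_density (t : R) : R :=
  if 0 < t then lam * t `^ (nu - 1) * mittag_leffler nu nu (- lam * t `^ nu)
  else 0.

Lemma continuous_ml_density (t : R) : 0 < t -> {for t, continuous ml_density}.
Proof.
move=> t0; pose f (t : R) := lam * t `^ (nu - 1) * mittag_leffler nu nu (- lam * t `^ nu).
have cf : {for t, continuous f}.
  apply: (@continuousM _ R^o (fun t => lam * t `^ (nu - 1))).
    apply: (@continuousM _ R^o (fun=> lam)); first exact: cst_continuous.
    exact: continuous_powR.
  apply: (@continuous_comp _ _ _ (fun t => - lam * t `^ nu)).
    apply: (@continuousM _ R^o (fun=> - lam)); first exact: cst_continuous.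
    exact: continuous_powR.
  exact: continuous_mittag_leffler.
have ft : f t = ml_density t by rewrite /ml_density t0.
rewrite /prop_for /continuous_at -ft; apply: cvg_trans cf.
apply: near_eq_cvg; near=> s; rewrite /ml_density ifT//.
by near: s; exact: lt_nbhsr.
Unshelve. all: end_near. Qed.

Lemma measurable_ml_density : measurable_fun [set: R] ml_density.
Proof.
apply: measurable_fun_ifT => //.
- exact: measurable_fun_ltr.
- apply: measurable_funM; first by apply: measurable_funM.
  apply: measurableT_comp; last exact: measurable_funM.
  by apply: continuous_measurable_fun; exact: continuous_mittag_leffler.
Qed.

(** The [j]-th term in the expansion of [expR (- (w * t)) * ml_density t] for [t > 0]. Its integral
    is the term of a geometric series of ratio [- lam / w ^ nu]. *)
Let u (w : R) j (t : R) : R :=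
  (-1) ^+ j * (lam ^+ j.+1 * c j) * (t `^ ((nu * j%:R + nu) - 1) * expR (- (w * t))).

Let int_u w j : 0 < w ->
  (\int[leb]_(t in `]0%R, +oo[) (u w j t)%:E =
   ((lam / w `^ nu) * (- (lam / w `^ nu)) ^+ j)%:E)%E.
Proof.
move=> w0; under eq_integral do rewrite /u EFinM.
rewrite integralZl//; last exact: integrable_gamma_scale.
rewrite integral_gamma_scale// -EFinM; congr (_%:E).
rewrite powRN powRD; last by rewrite (gt_eqF w0) implybT.
rewrite powRrM powR_mulrn ?powR_ge0// /c [in RHS]exprNn [in RHS]exprMn exprVn exprS.
have := gt_eqF (Gamma_gt0 (arg_gt0 j)); have := gt_eqF (powR_gt0 nu w0).
move=> /negbT h1 /negbT h2; field.
by rewrite h1 h2 expf_neq0.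
Qed.

Let int_abs_u w j : 0 < w ->
  (\int[leb]_(t in `]0%R, +oo[) `|(u w j t)%:E| =
   ((lam / w `^ nu) * (lam / w `^ nu) ^+ j)%:E)%E.
Proof.
move=> w0; under eq_integral.
  move=> t _; rewrite /u /= !normrM normrX normrN1 expr1n mul1r.
  rewrite (ger0_norm (powR_ge0 _ _)) (ger0_norm (expR_ge0 _)) -normrM EFinM.
  over.
rewrite integralZl//; last exact: integrable_gamma_scale.
rewrite integral_gamma_scale// -EFinM; congr (_%:E).
rewrite ger0_norm ?mulr_ge0 ?exprn_ge0 ?(ltW lam0) ?(ltW (c_gt0 _))//.
rewrite powRN powRD; last by rewrite (gt_eqF w0) implybT.
rewrite powRrM powR_mulrn ?powR_ge0// /c exprMn exprVn exprS.
have := gt_eqF (Gamma_gt0 (arg_gt0 j)); have := gt_eqF (powR_gt0 nu w0).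
move=> /negbT h1 /negbT h2; field.
by rewrite h1 h2 expf_neq0.
Qed.

(* Term-by-term integration needs [lam < w `^ nu]; large [w] suffice to invert
   the transform. *)
Lemma laplace_ml_density w : 0 < w -> lam < w `^ nu ->
  leb.-integrable `]0%R, +oo[ (fun t => (expR (- (w * t)) * ml_density t)%:E) /\
  (\int[leb]_(t in `]0%R, +oo[) (expR (- (w * t)) * ml_density t)%:E =
   (lam / (lam + w `^ nu))%:E)%E.
Proof.
move=> w0 lw; set r := lam / w `^ nu.
have wnu0 : 0 < w `^ nu by rewrite powR_gt0.
have r0 : 0 < r by rewrite divr_gt0.
have r1 : `|r| < 1 by rewrite gtr0_norm// ltr_pdivrMr// mul1r.
have [] := @integral_series _ _ R leb `]0, +oo[%classic (u w)
  (fun t => expR (- (w * t)) * ml_density t) (geometric r r).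
- by [].
- move=> j; apply/integrableP; split; last by rewrite int_abs_u// ltry.
  apply/measurable_EFinP; apply: measurable_funM => //.
  exact: measurable_powR_expR.
- apply: measurable_funM.
    apply: measurable_funTS; apply: measurableT_comp => //.
    by apply: measurableT_comp => //; exact: measurable_funM.
  exact: measurable_funTS measurable_ml_density.
- move=> t /=; rewrite in_itv/= andbT => t0.
  rewrite /ml_density t0 mlE [X in _ --> X]mulrA.
  rewrite (_ : series _ = fun n => (expR (- (w * t)) * (lam * t `^ (nu - 1))) *
     pseries c (- lam * t `^ nu) n).
    by apply: cvgMr; apply: is_cvg_entire; exact: entire_coef_mittag_leffler.
  apply/funext => n; rewrite /series/= mulr_sumr; apply: eq_bigr => j _.
  rewrite /u (_ : nu * j%:R + nu - 1 = nu * j%:R + (nu - 1)); last by rewrite addrA.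
  rewrite (@powRD _ t (nu * j%:R)); last by rewrite (gt_eqF t0) implybT.
  rewrite /= powRrM powR_mulrn ?powR_ge0// -(mulN1r lam) !exprMn exprS; ring.
- by move=> j; rewrite int_abs_u.
- exact: is_cvg_geometric_series.
move=> h1 h2; split; first exact: h1.
rewrite -(cvg_lim _ h2)//; apply/cvg_lim => //.
rewrite (_ : (fun n => _) = EFin \o series (geometric r (- r))); last first.
  apply/funext => n /=; rewrite -sumEFin; apply: eq_bigr => j _.
  by rewrite int_u.
apply: cvg_EFin; first exact: nearW.
have -> : lam / (lam + w `^ nu) = r * (1 - - r)^-1.
  by rewrite opprK /r; field; rewrite ?gt_eqF// addr_gt0.
by apply: cvg_geometric_series; rewrite normrN.
Qed.

End mittag_leffler_function.

(** * Inversion of the Laplace transform *)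

Section bernoulli.
Context {R : realType}.
Implicit Types (x y z : R).

Lemma bernoulli_le y N : 0 <= y <= 1 -> 1 - N%:R * y <= (1 - y) ^+ N.
Proof.
move=> /andP[y0 y1]; elim: N => [|N ih]; first by rewrite mul0r subr0 expr0.
rewrite exprS; apply: (@le_trans _ _ ((1 - y) * (1 - N%:R * y))).
  have : 0 <= N%:R * (y * y) by rewrite !mulr_ge0.
  by rewrite -natr1; lra.
by rewrite ler_wpM2l// subr_ge0.
Qed.

(** Companion of Bernoulli's inequality, bounding [(1 - y) ^ N] from above; the induction step is
    [(1 - y) (1 + (N + 1) y) <= 1 + N y]. *)
Lemma bernoulli_ge y N : 0 <= y <= 1 -> (1 - y) ^+ N * (1 + N%:R * y) <= 1.
Proof.
move=> /andP[y0 y1]; elim: N => [|N ih]; first by rewrite mul0r addr0 mulr1 expr0.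
apply: le_trans ih; rewrite exprSr -mulrA ler_wpM2l ?exprn_ge0 ?subr_ge0//.
have : 0 <= N%:R * (y * y) by rewrite !mulr_ge0.
have : 0 <= y * y by rewrite mulr_ge0.
by rewrite -natr1; lra.
Qed.

(** With [a = - ln z], the bound [expR (a n) >= 1 + (a n) ^ 2 / 2] makes [n z ^ n] of order
    [1 / n]. *)
Lemma cvg_natr_expr z : 0 <= z < 1 -> n%:R * z ^+ n @[n --> \oo] --> (0 : R).
Proof.
move=> /andP[z0 z1]; have [->|zn0] := eqVneq z 0.
  rewrite (_ : (fun n => _) = cst 0); first exact: cvg_cst.
  by apply/funext => -[|n]; rewrite ?mul0r// expr0n mulr0.
have zgt0 : 0 < z by rewrite lt_neqAle eq_sym zn0.
pose a := - ln z; have a0 : 0 < a by rewrite oppr_gt0 ln_lt0// zgt0.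
have zE n : z ^+ n = expR (- (a * n%:R)).
  by rewrite /a mulNr opprK mulrC expRM_natl lnK.
apply: (@squeeze_cvgr _ _ _ _ (cst 0) (fun n => 4 / a ^+ 2 * harmonic n)).
- apply: nearW => -[|n]; rewrite mulr_ge0 ?exprn_ge0 ?mul0r//=.
    by rewrite mulr_ge0// ?invr_ge0// divr_ge0// exprn_ge0// ltW.
  rewrite zE expRN ler_pdivrMr ?expR_gt0//.
  have an0 : 0 <= a * n.+1%:R by rewrite mulr_ge0// ltW.
  apply: le_trans (_ : 4 / a ^+ 2 / n.+2%:R * (1 + (a * n.+1%:R) ^+ 2 / 2) <= _); last first.
    by rewrite ler_wpM2l ?(@expR_ge1Dxn _ _ 1)// !mulr_ge0 ?invr_ge0// exprn_ge0// ltW.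
  rewrite mulrAC ler_pdivlMr// exprMn.
  have -> : 4 / a ^+ 2 * (1 + a ^+ 2 * n.+1%:R ^+ 2 / 2) =
     4 / a ^+ 2 + 2 * n.+1%:R ^+ 2 :> R by field; rewrite gt_eqF.
  have : 0 <= 4 / a ^+ 2 by rewrite divr_ge0// exprn_ge0// ltW.
  rewrite -(natr1 n.+1) -(natr1 n); have := ler0n R n; nra.
- exact: cvg_cst.
- by rewrite -[X in _ --> X](mulr0 (4 / a ^+ 2)); apply: cvgMr; exact: cvg_harmonic.
Qed.

End bernoulli.

Section cutoff.
Context {R : realType}.
Implicit Types (x y z : R).

(* With [x = expR (- s * t)] and [expR (- s * c) = k^-1], this polynomial in
   [x] without constant term tends to the indicator function of [t <= c]. *)
Definition cutoff (k n : nat) x : R := 1 - (1 - x ^+ n) ^+ (n * k ^ n).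

Variables (k : nat) (k2 : (2 <= k)%N).

Let xn01 x n : 0 <= x <= 1 -> 0 <= x ^+ n <= 1.
Proof. by move=> /andP[x0 x1]; rewrite exprn_ge0// exprn_ile1. Qed.

Let NxE x n : (n * k ^ n)%:R * x ^+ n = n%:R * (k%:R * x) ^+ n.
Proof. by rewrite natrM natrX -mulrA -exprMn. Qed.

Lemma cutoff_ge0 x n : 0 <= x <= 1 -> 0 <= cutoff k n x.
Proof.
move=> /(@xn01 _ n)/andP[x0 x1].
by rewrite /cutoff subr_ge0 exprn_ile1// ?subr_ge0// gerBl.
Qed.

Lemma cutoff_le1 x n : 0 <= x <= 1 -> cutoff k n x <= 1.
Proof.
move=> /(@xn01 _ n)/andP[x0 x1].
by rewrite /cutoff gerBl exprn_ge0// subr_ge0.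
Qed.

Lemma cutoff_leM x n : 0 <= x <= 1 -> cutoff k n x <= n%:R * (k%:R * x) ^+ n.
Proof.
move=> /(@xn01 _ n) h; have := bernoulli_le (n * k ^ n) h.
by rewrite NxE /cutoff lerBlDr lerBlDl.
Qed.

(** Domination uniform in [n]. If [k ^ 2 x >= 1] the bound 1 suffices; otherwise [k x <= 1 / 2], and
    in [n (k x) ^ n] one factor [k x] is kept while the others beat [n]. *)
Lemma cutoff_bound x n : 0 <= x <= 1 -> cutoff k n x <= 2 * k%:R ^+ 2 * x.
Proof.
move=> x01; have /andP[x0 x1] := x01.
have k0 : 0 < k%:R :> R by rewrite ltr0n (leq_trans _ k2).
have k1 : 1 <= k%:R :> R by rewrite ler1n (leq_trans _ k2).
have [h|h] := leP 1 (k%:R ^+ 2 * x).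
  apply: le_trans (cutoff_le1 _ x01) _; rewrite -mulrA.
  by apply: le_trans h _; rewrite ler_peMl ?ler1n// mulr_ge0// exprn_ge0// ltW.
case: n => [|n].
  by rewrite /cutoff mul0n expr0 subrr !mulr_ge0// ltW.
apply: le_trans (cutoff_leM _ x01) _.
have kx : k%:R * x <= 2^-1.
  rewrite -(@ler_pM2l _ k%:R)// mulrA -expr2; apply: (le_trans (ltW h)).
  by rewrite ler_pdivlMr// mul1r ler_nat.
rewrite exprS mulrCA [leRHS](_ : _ = k%:R * x * (2 * k%:R)); last by ring.
rewrite ler_wpM2l ?mulr_ge0 ?(ltW k0)//.
apply: (@le_trans _ _ 2); last by rewrite ler_peMr.
apply: (@le_trans _ _ (n.+1%:R * 2^-1 ^+ n)).
  by rewrite ler_wpM2l// lerXn2r// nnegrE// mulr_ge0// ltW.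
rewrite exprVn ler_pdivrMr ?exprn_gt0// -exprS -natrX ler_nat ltnW//.
exact: ltn_expl.
Qed.

Lemma cvg_cutoff0 x : 0 <= x <= 1 -> k%:R * x < 1 ->
  cutoff k n x @[n --> \oo] --> (0 : R).
Proof.
move=> x01 kx; have /andP[x0 x1] := x01.
apply: (@squeeze_cvgr _ _ _ _ (cst 0) (fun n => n%:R * (k%:R * x) ^+ n)).
- by apply: nearW => n; rewrite cutoff_ge0//= cutoff_leM.
- exact: cvg_cst.
- by apply: cvg_natr_expr; rewrite kx mulr_ge0.
Qed.

(** The factor [n] in the exponent [n * k ^ n] settles the boundary case [k x = 1]: there
    [(1 - x ^ n) ^ (n k ^ n)] is at most [1 / (n + 1)], while the exponent [k ^ n] alone would give
    the limit [expR (-1)]. *)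
Lemma cvg_cutoff1 x : 0 <= x <= 1 -> 1 <= k%:R * x ->
  cutoff k n x @[n --> \oo] --> (1 : R).
Proof.
move=> x01 kx; have /andP[x0 x1] := x01.
rewrite -[X in _ --> X]subr0; apply: cvgB; first exact: cvg_cst.
apply: (@squeeze_cvgr _ _ _ _ (cst 0) harmonic).
- apply: nearW => n; have /andP[xn0 xn1] := xn01 n x01.
  rewrite /= exprn_ge0 ?subr_ge0//=.
  have := bernoulli_ge (n * k ^ n) (xn01 n x01); rewrite NxE.
  rewrite -[n.+1%:R^-1]mul1r ler_pdivlMr//; apply: le_trans.
  rewrite ler_wpM2l ?exprn_ge0 ?subr_ge0// -natr1 addrC lerD2l.
  by rewrite ler_peMr// exprn_ege1.
- exact: cvg_cst.
- exact: cvg_harmonic.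
Qed.

End cutoff.

Section laplace_inversion.
Context {R : realType}.

Section one_space.
Context d (T : measurableType d) (mu : {measure set T -> \bar R}).
Variables (D : set T) (mD : measurable D) (tau rho : T -> R).
Hypotheses (mtau : measurable_fun D tau) (mrho : measurable_fun D rho).
Hypothesis tau0 : forall x, D x -> 0 <= tau x.

(** The weight [rho] may change sign and is integrable only against the exponential; the linear
    bound [cutoff_bound] is exactly what dominated convergence requires in that situation. *)
Lemma laplace_cutoff_cvg (s c : R) (k : nat) : (2 <= k)%N -> 0 < s ->
  expR (- (s * c)) = k%:R^-1 ->
  mu.-integrable D (fun x => (expR (- (s * tau x)) * rho x)%:E) ->
  (\int[mu]_(x in D) (cutoff k n (expR (- (s * tau x))) * rho x)%:E)%E
    @[n --> \oo] -->
  (\int[mu]_(x in D `&` [set x | (tau x <= c)%R]) (rho x)%:E)%E.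
Proof.
move=> k2 s0 sck ie.
have k0 : 0 < k%:R :> R by rewrite ltr0n (leq_trans _ k2).
have me : measurable_fun D (fun x => expR (- (s * tau x))).
  do 2 (apply: measurableT_comp => //); exact: measurable_funM.
have mA : measurable (D `&` [set x | tau x <= c]).
  have := mtau mD (measurable_itv `]-oo, c]).
  by congr (measurable _); apply/seteqP; split => x /=; rewrite in_itv.
have e01 x : D x -> 0 <= expR (- (s * tau x)) <= 1.
  by move=> Dx; rewrite expR_ge0 -expR0 ler_expR oppr_le0 mulr_ge0// ?tau0// ltW.
rewrite (_ : D `&` _ = D `&` (D `&` [set x | tau x <= c])); last first.
  by rewrite setIA setIid.
rewrite integral_mkcondr.
have [] := @dominated_convergence _ T R mu D mD
  (fun n x => (cutoff k n (expR (- (s * tau x))) * rho x)%:E)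
  ((EFin \o rho) \_ (D `&` [set x | tau x <= c]))
  (fun x => `| (2 * k%:R ^+ 2)%:E * (expR (- (s * tau x)) * rho x)%:E |)%E.
- move=> n; apply/measurable_EFinP; apply: measurable_funM => //.
  apply: measurable_funB => //; apply: measurable_funX.
  by apply: measurable_funB => //; exact: measurable_funX.
- apply/measurable_restrict => //; rewrite setIA setIid.
  by apply: measurable_funS mD _ _ => //; exact/measurable_EFinP.
- apply: aeW => x Dx; rewrite patchE.
  have ks : k%:R * expR (- (s * tau x)) = expR (s * (c - tau x)).
    by rewrite -[k%:R]invrK -sck -expRN opprK -expRD mulrBr.
  case: ifPn => [/set_mem[_ /= tc]|/negP tc].
    apply: cvg_EFin; first exact: nearW.
    rewrite -[X in _ --> X]mul1r; apply: cvgMl.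
    apply: cvg_cutoff1; rewrite ?e01// ks -expR0 ler_expR mulr_ge0 ?(ltW s0)//.
    by rewrite subr_ge0.
  apply: cvg_EFin; first exact: nearW.
  rewrite -[X in _ --> X](mul0r (rho x)); apply: cvgMl.
  apply: cvg_cutoff0; rewrite ?e01// ks -expR0 ltr_expR pmulr_rlt0// subr_lt0.
  by rewrite ltNge; apply/negP => h; apply: tc; rewrite inE.
- by apply: integrable_abse; exact: integrableZl.
- apply: aeW => x n Dx; rewrite -EFinM !abse_EFin lee_fin [in leRHS]mulrA.
  rewrite !(normrM _ (rho x)) ler_wpM2r// ger0_norm ?cutoff_ge0 ?e01//.
  by apply: le_trans (ler_norm _); apply: cutoff_bound => //; exact: e01.
by move=> _ _.
Qed.

End one_space.

Section two_spaces.
Context d1 (T1 : measurableType d1) (mu1 : {measure set T1 -> \bar R}).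
Context d2 (T2 : measurableType d2) (mu2 : {measure set T2 -> \bar R}).
Variables (D1 : set T1) (D2 : set T2) (mD1 : measurable D1) (mD2 : measurable D2).
Variables (tau1 rho1 : T1 -> R) (tau2 rho2 : T2 -> R).
Hypotheses (mtau1 : measurable_fun D1 tau1) (mrho1 : measurable_fun D1 rho1).
Hypotheses (mtau2 : measurable_fun D2 tau2) (mrho2 : measurable_fun D2 rho2).
Hypothesis tau1_ge0 : forall x, D1 x -> 0 <= tau1 x.
Hypothesis tau2_ge0 : forall x, D2 x -> 0 <= tau2 x.
Variables (w0 : R) (w0_gt0 : 0 < w0).
Hypothesis int1 : forall w, w0 <= w ->
  mu1.-integrable D1 (fun x => (expR (- (w * tau1 x)) * rho1 x)%:E).
Hypothesis int2 : forall w, w0 <= w ->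
  mu2.-integrable D2 (fun x => (expR (- (w * tau2 x)) * rho2 x)%:E).
Hypothesis laplace_eq : forall w, w0 <= w ->
  (\int[mu1]_(x in D1) (expR (- (w * tau1 x)) * rho1 x)%:E =
   \int[mu2]_(x in D2) (expR (- (w * tau2 x)) * rho2 x)%:E)%E.

(* The functions of [expR (- s * tau)] with the same integral on both sides. *)
Let same (s : R) (g : R -> R) :=
  [/\ mu1.-integrable D1 (fun x => (g (expR (- (s * tau1 x))) * rho1 x)%:E),
      mu2.-integrable D2 (fun x => (g (expR (- (s * tau2 x))) * rho2 x)%:E) &
      (\int[mu1]_(x in D1) (g (expR (- (s * tau1 x))) * rho1 x)%:E =
       \int[mu2]_(x in D2) (g (expR (- (s * tau2 x))) * rho2 x)%:E)%E].

Let sameD s g h : same s g -> same s h -> same s (fun x => g x + h x).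
Proof.
move=> [g1 g2 g12] [h1 h2 h12]; split.
- by under eq_fun do rewrite mulrDl EFinD; exact: integrableD.
- by under eq_fun do rewrite mulrDl EFinD; exact: integrableD.
- under eq_integral do rewrite mulrDl EFinD.
  under [RHS]eq_integral do rewrite mulrDl EFinD.
  by rewrite !integralD_EFin// g12 h12.
Qed.

Let sameN s g : same s g -> same s (fun x => - g x).
Proof.
move=> [g1 g2 g12]; split.
- by under eq_fun do rewrite mulNr EFinN; exact: integrableN.
- by under eq_fun do rewrite mulNr EFinN; exact: integrableN.
- under eq_integral do rewrite -mulN1r -mulrA EFinM.
  under [RHS]eq_integral do rewrite -mulN1r -mulrA EFinM.
  by rewrite !integralZl// g12.
Qed.

Let same_ext s g h : g =1 h -> same s g -> same s h.
Proof. by move=> /funext ->. Qed.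

Let sameX s n : w0 <= s -> same s (fun x => x ^+ n.+1).
Proof.
move=> ws.
have e (y : R) : expR (- (s * y)) ^+ n.+1 = expR (- ((n.+1%:R * s) * y)).
  by rewrite -expRM_natl mulrN mulrA.
have w1 : w0 <= n.+1%:R * s.
  have s0 : 0 <= s := le_trans (ltW w0_gt0) ws.
  by apply: (le_trans ws); rewrite ler_peMl ?ler1n.
split; [under eq_fun do rewrite e; exact: int1|
  under eq_fun do rewrite e; exact: int2|].
under eq_integral do rewrite e.
by under [RHS]eq_integral do rewrite e; exact: laplace_eq.
Qed.

Let same_cutoff s k n : w0 <= s -> same s (cutoff k n).
Proof.
move=> ws; rewrite /cutoff; case: n => [|n].
  apply: (@same_ext _ (fun x => x ^+ 1 + - x ^+ 1)).
    by move=> x; rewrite addrN mul0n expr0 subrr.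
  by apply: sameD; [exact: sameX|apply: sameN; exact: sameX].
suff h N m : same s (fun x => x ^+ m * (1 - (1 - x ^+ n.+1) ^+ N)).
  by apply: same_ext (h (n.+1 * k ^ n.+1)%N 0%N) => x; rewrite expr0 mul1r.
elim: N m => [|N ih] m.
  apply: (@same_ext _ (fun x => x ^+ 1 + - x ^+ 1)).
    by move=> x; rewrite addrN expr0 subrr mulr0.
  by apply: sameD; [exact: sameX|apply: sameN; exact: sameX].
apply: (@same_ext _ (fun x => (x ^+ m * (1 - (1 - x ^+ n.+1) ^+ N) + x ^+ (m + n).+1)
    + - (x ^+ (m + n.+1) * (1 - (1 - x ^+ n.+1) ^+ N)))).
  by move=> x; rewrite -addnS exprD [in RHS]exprS; ring.
by apply: sameD; [apply: sameD; [exact: ih|exact: sameX]|apply: sameN; exact: ih].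
Qed.

Lemma laplace_inj (c : R) : 0 < c ->
  (\int[mu1]_(x in D1 `&` [set x | (tau1 x <= c)%R]) (rho1 x)%:E =
   \int[mu2]_(x in D2 `&` [set x | (tau2 x <= c)%R]) (rho2 x)%:E)%E.
Proof.
(* As [k >= expR (w0 * c)], the point [s = ln k / c] is at least [w0], and the powers of
   [expR (- (s * t))] only involve the transforms at multiples of [s], where they are known to
   agree. *)
move=> c0; pose k := (Num.bound (expR (w0 * c))).+2.
have k2 : (2 <= k)%N by [].
have k0 : 0 < k%:R :> R by rewrite ltr0n.
pose s := ln k%:R / c.
have sc : s * c = ln k%:R by rewrite /s divfK// gt_eqF.
have ws : w0 <= s.
  rewrite /s ler_pdivlMr// -ler_expR lnK ?posrE//.
  apply/ltW/(lt_le_trans (archi_boundP (expR_ge0 _))).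
  by rewrite ler_nat /k ltnW.
have sck : expR (- (s * c)) = k%:R^-1 by rewrite expRN sc lnK// posrE.
have s0 : 0 < s by exact: lt_le_trans ws.
have h1 := laplace_cutoff_cvg mD1 mtau1 mrho1 tau1_ge0 k2 s0 sck (int1 ws).
have h2 := laplace_cutoff_cvg mD2 mtau2 mrho2 tau2_ge0 k2 s0 sck (int2 ws).
rewrite -(cvg_lim _ h1)// -(cvg_lim _ h2)//; congr (limn _).
by apply/funext => n; have [] := same_cutoff k n ws.
Qed.

End two_spaces.
End laplace_inversion.

(** * Measures determined by their distribution functions *)

Lemma fin_num_leeDl_ge0 (R : realDomainType) (x y : \bar R) :
  x \is a fin_num -> (x <= x + y)%E -> (0 <= y)%E.
Proof.
case: x => // r _; case: y => [s||]//.
by rewrite -EFinD !lee_fin lerDl.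
Qed.

Section ae_measure.
Context d (T : measurableType d) (R : realType) (mu : {measure set T -> \bar R}).

Lemma ae_imp_le_measure (A B : set T) : measurable A -> measurable B ->
  {ae mu, forall x, A x -> B x} -> (mu A <= mu B)%E.
Proof.
move=> mA mB [N [mN N0 AB]]; apply: (@le_trans _ _ (mu (B `|` N))).
  apply: le_measure; rewrite ?inE//; first exact: measurableU.
  move=> x Ax; have [Bx|nBx] := pselect (B x); [by left|right; apply: AB => /=].
  by move=> /(_ Ax).
by rewrite (measureU0 mB mN N0).
Qed.

Lemma ae_eq_measure (A B : set T) : measurable A -> measurable B ->
  {ae mu, forall x, A x <-> B x} -> mu A = mu B.
Proof.
move=> mA mB AB; apply/eqP; rewrite eq_le; apply/andP; split;
  by apply: ae_imp_le_measure => //; apply: filterS AB => x [].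
Qed.

End ae_measure.

Section pdf_of_cdf.
Context {R : realType}.
Local Notation leb := (@lebesgue_measure R).

Lemma measure_eq_of_cdf (m1 m2 : {measure set (measurableTypeR R) -> \bar R}) :
  (forall c : R, m1 `]-oo, c]%classic = m2 `]-oo, c]%classic) ->
  (forall c : R, (m1 `]-oo, c]%classic < +oo)%E) ->
  forall A, measurable A -> m1 A = m2 A.
Proof.
move=> m12 m1oo A mA.
have sub (a b : R) : `]a, b]%classic = `]-oo, b] `\` `]-oo, a] :> set R.
  apply/seteqP; split => x /=; rewrite !in_itv/=; first by case/andP; rewrite ltNge => /negP.
  by move=> [-> /negP]; rewrite -ltNge => ->.
have mI c : measurable (`]-oo, c]%classic : set (measurableTypeR R)).
  exact: measurable_itv.
have eq_oc (a b : R) : m1 `]a, b]%classic = m2 `]a, b]%classic.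
  have m2oo : (m2 `]-oo, b]%classic < +oo)%E by rewrite -m12.
  have D1 := measureD (mI b) (mI a) (m1oo b).
  have D2 := measureD (mI b) (mI a) m2oo.
  rewrite sub; apply: (etrans D1); apply: (etrans _ (esym D2)).
  have [ab|ba] := leP a b.
    have -> : `]-oo, b] `&` `]-oo, a] = `]-oo, a]%classic :> set R.
      by apply: setIidr; apply: subset_itvl; rewrite bnd_simp.
    by congr (_ - _)%E; exact: m12.
  have -> : `]-oo, b] `&` `]-oo, a] = `]-oo, b]%classic :> set R.
    by apply: setIidl; apply: subset_itvl; rewrite bnd_simp ltW.
  by congr (_ - _)%E; exact: m12.
apply: (@measure_unique _ R (measurableTypeR R) (@ocitv R)
  (fun n => `](- n%:R)%R, n%:R]%classic)) => //.
- exact: ocitvI.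
- by move=> i; exact: is_ocitv.
- apply/seteqP; split => // x _; exists (Num.bound `|x|) => //=.
  rewrite in_itv/=.
  have := archi_boundP (normr_ge0 x); rewrite ltr_norml => /andP[-> /ltW ->//].
- by move=> _ [[a b] _ <-]; exact: eq_oc.
- move=> k; apply: le_lt_trans (m1oo k%:R); apply: le_measure; rewrite ?inE//.
  by apply: subset_itvr.
Qed.

End pdf_of_cdf.

Section density_measure.
Context {R : realType}.
Local Notation leb := (@lebesgue_measure R).
Variables (f : R -> R) (mf : measurable_fun [set: R] f) (f0 : forall x, 0 <= f x).

Definition density_measure (A : set (measurableTypeR R)) : \bar R :=
  (\int[leb]_(x in A) (f x)%:E)%E.

Let density0 : density_measure set0 = 0%E.
Proof. by rewrite /density_measure integral_set0. Qed.

Let density_ge0 A : (0 <= density_measure A)%E.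
Proof. by apply: integral_ge0 => x _; rewrite lee_fin. Qed.

Let density_sigma_additive : semi_sigma_additive density_measure.
Proof.
move=> /= F mF tF mUF; rewrite /density_measure; apply: cvg_toP.
  apply: ereal_nondecreasing_is_cvgn => m n mn.
  by apply: lee_sum_nneg_natr => // k _ _; apply: integral_ge0 => x _; rewrite lee_fin.
rewrite ge0_integral_bigcup//=.
- by apply/measurable_EFinP; exact: measurable_funTS.
- by move=> x _; rewrite lee_fin.
Qed.

HB.instance Definition _ := isMeasure.Build _ _ _
  density_measure density0 density_ge0 density_sigma_additive.

Lemma density_measure_unique (m : {measure set (measurableTypeR R) -> \bar R}) :
  (forall c : R, m `]-oo, c]%classic = density_measure `]-oo, c]%classic) ->
  (forall c : R, (m `]-oo, c]%classic < +oo)%E) ->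
  forall A, measurable A -> m A = density_measure A.
Proof. by move=> h1 h2; apply: measure_eq_of_cdf. Qed.

End density_measure.

(** * From the Laplace transform to the Mittag-Leffler density *)

Section pdf_of_laplace.
Context d (T : measurableType d) (R : realType) (P : probability T R).
Local Notation leb := (@lebesgue_measure R).
Variables (nu lam : R) (nu0 : 0 < nu) (lam0 : 0 < lam).
Variables (Y : T -> \bar R) (y : T -> R).
Hypotheses (mY : measurable_fun [set: T] Y) (my : measurable_fun [set: T] y).
Hypotheses (y0 : forall x, 0 <= y x) (Yy : {ae P, forall x, Y x = (y x)%:E}).
Hypothesis laplace_y : forall w, 0 < w ->
  (\int[P]_x (expR (- (w * y x)))%:E = (lam / (lam + w `^ nu))%:E)%E.

Local Notation f := (ml_density nu lam).

Let mle c : measurable [set x | y x <= c].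
Proof.
have := my measurableT (measurable_itv `]-oo, c]); rewrite setTI.
by congr (measurable _); apply/seteqP; split => x /=; rewrite in_itv.
Qed.

(** Chosen so that [w0 ^ nu = lam + 1], beyond the threshold [lam] required for the transform of the
    density. *)
Let w0 : R := (lam + 1) `^ nu^-1.

Let w0_gt0 : 0 < w0.
Proof. by rewrite powR_gt0// addr_gt0. Qed.

Let lam_lt w : w0 <= w -> lam < w `^ nu.
Proof.
move=> ww; apply: (@lt_le_trans _ _ (w0 `^ nu)).
  by rewrite -powRrM mulVf ?gt_eqF// powRr1 ?ltrDl// addr_ge0// ltW.
by rewrite ge0_ler_powR ?nnegrE ?(ltW nu0) ?(ltW w0_gt0)// (le_trans (ltW w0_gt0)).
Qed.

(** The inversion compares [P] with weight 1 and variable [y] to Lebesgue measure on []0, +oo[] with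
    weight [f], whose sign is still unknown. *)
Let cdf_pos c : 0 < c ->
  P [set x | y x <= c] = (\int[leb]_(t in `]0%R, c]) (f t)%:E)%E.
Proof.
move=> c0.
have mid : measurable_fun (`]0, +oo[%classic : set (measurableTypeR R)) (fun t : R => t).
  exact: measurable_funTS.
have mf : measurable_fun (`]0, +oo[%classic : set (measurableTypeR R)) f.
  exact: measurable_funTS (measurable_ml_density nu0 lam).
have id0 (x : R) : `]0, +oo[%classic x -> 0 <= x.
  by rewrite /= in_itv/= andbT => /ltW.
have i1 w : w0 <= w -> P.-integrable [set: T] (fun x => (expR (- (w * y x)) * 1)%:E).
  move=> ww; apply/integrableP; split.
    apply/measurable_EFinP; apply: measurable_funM => //.
    by do 2 (apply: measurableT_comp => //); exact: measurable_funM.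
  under eq_integral do rewrite mulr1 /= ger0_norm ?expR_ge0//.
  by rewrite laplace_y ?ltry// (lt_le_trans w0_gt0).
have wgt w : w0 <= w -> 0 < w by exact: lt_le_trans.
have := @laplace_inj R d T P _ (measurableTypeR R) leb [set: T] `]0, +oo[%classic
  measurableT (measurable_itv _) y (fun=> 1) (fun t => t) f my
  (measurable_cst _) mid mf (fun x _ => y0 x) id0 w0 w0_gt0 i1
  (fun w ww => (laplace_ml_density nu0 lam0 (wgt _ ww) (lam_lt ww)).1) _ c c0.
rewrite integral_cst; last by rewrite setTI.
rewrite mul1e setTI => -> //.
  congr (integral _ _ _); apply/seteqP; split => x /=; rewrite !in_itv/= ?andbT.
    by move=> [-> ->].
  by move=> /andP[].
move=> w ww; rewrite (laplace_ml_density nu0 lam0 (wgt _ ww) (lam_lt ww)).2.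
by under eq_integral do rewrite mulr1; rewrite laplace_y// wgt.
Qed.

Let integrable_f c : leb.-integrable `]0%R, c] (fun t => (f t)%:E).
Proof.
have [i0 _] := laplace_ml_density nu0 lam0 w0_gt0 (lam_lt (lexx _)).
apply: (@le_integrable _ _ _ leb _ _ _
  (fun t => (expR (w0 * c))%:E * (expR (- (w0 * t)) * f t)%:E)%E) => //.
- by apply/measurable_EFinP; exact: measurable_funTS (measurable_ml_density nu0 lam).
- move=> t /=; rewrite in_itv/= => /andP[t0 tc].
  rewrite lee_fin mulrA -expRD normrM ler_peMl// ger0_norm ?expR_ge0//.
  by rewrite -expR0 ler_expR subr_ge0 ler_wpM2l// ltW.
- apply: integrableZl => //; apply: integrableS i0 => //.
  by apply: subset_itvl.
Qed.

(** The sign is inherited from [P]: if [f t < 0], continuity gives [f <= f t / 2] on some []t, b]],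
    so the integral of [f] there is negative, although by [cdf_pos] it is an increment of a
    distribution function. *)
Let ml_ge0 t : 0 <= f t.
Proof.
have [t0|t0] := ltP 0 t; last by rewrite /ml_density ltNge t0.
rewrite leNgt; apply/negP => ft0.
have half_lt (u v : R) : - - (u / 2) < u - v -> v < u / 2 by lra.
have ct := @continuous_ml_density _ _ nu0 lam _ t0.
have : \forall s \near t, f s < f t / 2.
  move/cvgrPdist_lt: ct => /(_ (- (f t / 2))); rewrite oppr_gt0 pmulr_llt0// => /(_ ft0).
  apply: filterS => s; rewrite ltr_norml => /andP[h _].
  exact: half_lt h.
move=> /nbhs_ballP[e /= e0 he].
pose a := t; pose b := t + e / 2.
have ab : a < b by rewrite ltrDl divr_gt0.
have a0 : 0 < a by [].
have fs s : `]a, b]%classic s -> f s <= f t / 2.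
  rewrite /= in_itv/= => /andP[as_ sb]; apply/ltW/he; rewrite /ball/=.
  by rewrite ltr0_norm ?subr_lt0// opprB ltrBlDl (le_lt_trans sb)// ltrD2l; lra.
have i2 : leb.-integrable `]a, b] (fun t => (f t)%:E).
  apply: integrableS (integrable_f b) => //; apply: subset_itvr.
  by rewrite bnd_simp ltW.
have h1 : (\int[leb]_(s in `]a, b]) (f s)%:E <= (f t / 2 * (b - a))%:E)%E.
  have -> : (f t / 2 * (b - a))%:E = (\int[leb]_(s in `]a, b]) (cst (f t / 2)%:E s))%E.
    by rewrite integral_cst//= lebesgue_measure_itv/= lte_fin ab.
  apply: le_integral => //.
    apply/integrableP; split; first exact: measurable_cst.
    rewrite (_ : (fun x => _) = cst `|(f t / 2)%:E|%E)//.
    by rewrite integral_cst//= lebesgue_measure_itv/= lte_fin ab -EFinM ltry.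
  by move=> s; rewrite inE => sab; rewrite lee_fin fs.
have : (0 <= \int[leb]_(s in `]a, b]) (f s)%:E)%E.
  have Eb : `]0, b]%classic = `]0, a] `|` `]a, b] :> set R.
    by rewrite -itv_bndbnd_setU ?bnd_simp ?(ltW ab) ?(ltW a0).
  have : (P [set x | (y x <= a)%R] <= P [set x | (y x <= b)%R])%E.
    by apply: le_measure; rewrite ?inE// => x /= /le_trans; apply; exact: ltW.
  have Pf : P [set x | y x <= a] \is a fin_num by exact: fin_num_measure.
  rewrite (cdf_pos (lt_trans a0 ab)) Eb integral_setU//.
  - by rewrite -(cdf_pos a0); exact: fin_num_leeDl_ge0.
  - by apply/measurable_EFinP; exact: measurable_funTS (measurable_ml_density nu0 lam).
  - apply/disj_setPS => x [] /=; rewrite !in_itv/= => /andP[_ x1] /andP[x2 _].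
    by move: x1; rewrite leNgt x2.
move=> /le_trans/(_ h1); rewrite lee_fin leNgt => /negP; apply.
by rewrite pmulr_llt0 ?subr_gt0// pmulr_llt0.
Qed.

(** A mass [p > 0] at 0 would keep the transform above [p] at every [w], but where
    [w ^ nu = lam / p] the transform is [p / (1 + p) < p]. *)
Let P_le0 : P [set x | y x <= 0] = 0%E.
Proof.
apply/eqP; rewrite -measure_le0 leNgt; apply/negP => P0.
pose p : \bar R := P [set x | y x <= 0].
have {}P0 : (0 < p)%E := P0.
have pf : p \is a fin_num by exact: fin_num_measure.
have fp0 : 0 < fine p by rewrite fine_gt0// P0 ltey_eq pf.
pose w := (lam / fine p) `^ nu^-1.
have wl0 : 0 < lam / fine p by rewrite divr_gt0.
have wgt0 : 0 < w by rewrite powR_gt0.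
have : (p <= \int[P]_x (expR (- (w * y x)))%:E)%E.
  have -> : p = (\int[P]_(x in [set x | (y x <= 0)%R]) (cst 1%:E x))%E.
    by rewrite integral_cst// mul1e.
  apply: (@le_trans _ _ (\int[P]_(x in [set x | (y x <= 0)%R]) (expR (- (w * y x)))%:E)%E).
    have -> // : (\int[P]_(x in [set x | (y x <= 0)%R]) (cst 1%:E x))%E =
      (\int[P]_(x in [set x | (y x <= 0)%R]) (expR (- (w * y x)))%:E)%E.
    apply: eq_integral => x; rewrite inE /= => yx.
    have -> : y x = 0 by apply/eqP; rewrite eq_le yx y0.
    by rewrite mulr0 oppr0 expR0.
  apply: ge0_subset_integral => //=.
  apply/measurable_EFinP.
  by do 2 (apply: measurableT_comp => //); exact: measurable_funM.
rewrite laplace_y// -[p]fineK// lee_fin -powRrM mulVf ?gt_eqF// powRr1 ?(ltW wl0)//.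
rewrite ler_pdivlMr ?addr_gt0// mulrDr mulrC (mulrC (fine p) (lam / _)) divfK ?gt_eqF//.
by rewrite gerDr leNgt mulr_gt0.
Qed.

Lemma has_pdf_ml_density : has_pdf P Y f.
Proof.
have mf := measurable_ml_density nu0 lam.
split => // B mB.
have mB' : measurable (EFin @^-1` B).
  by rewrite -[X in measurable X]setTI; exact: EFin_measurable.
have mYB : measurable (Y @^-1` B) by rewrite -[X in measurable X]setTI; exact: mY.
have myB : measurable (y @^-1` (EFin @^-1` B)).
  by rewrite -[X in measurable X]setTI; exact: my.
rewrite (@ae_eq_measure _ _ _ P _ (y @^-1` (EFin @^-1` B)))//; last first.
  by apply: filterS Yy => x /= ->.
have my' : measurable_fun [set: T] (y : T -> measurableTypeR R) by [].
pose m2 := density_measure f.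
have m2E : m2 (EFin @^-1` B) = (\int[leb]_(x in EFin @^-1` B) (f x)%:E)%E by [].
rewrite -m2E.
have Pcdf (c : R) : pushforward P (y : T -> measurableTypeR R) `]-oo, c]%classic = m2 `]-oo, c]%classic.
  have -> : pushforward P (y : T -> measurableTypeR R) `]-oo, c]%classic = P [set x | y x <= c].
    by rewrite /pushforward; congr (P _); apply/seteqP; split => x /=; rewrite in_itv.
  have [c0|c0] := ltP 0 c.
    rewrite cdf_pos// /m2 /density_measure.
    have -> : `]-oo, c]%classic = `]-oo, 0] `|` `]0, c] :> set R.
      by rewrite -itv_bndbnd_setU ?bnd_simp// ltW.
    rewrite integral_setU//.
    - rewrite integral0_eq ?add0e// => x /=; rewrite in_itv/= => x0.
      by rewrite /ml_density ltNge x0.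
    - by apply/measurable_EFinP; exact: measurable_funTS.
    - apply/disj_setPS => x [] /=; rewrite !in_itv/= => x1 /andP[x2 _].
      by move: x1; rewrite leNgt x2.
  rewrite /m2 /density_measure integral0_eq; last first.
    by move=> x /=; rewrite in_itv/= => xc; rewrite /ml_density ltNge (le_trans xc).
  apply/eqP; rewrite -measure_le0 -P_le0; apply: le_measure; rewrite ?inE//.
  by move=> x /= /le_trans; apply.
apply: (@density_measure_unique R f mf ml_ge0
  (pushforward P (y : T -> measurableTypeR R))) => //.
move=> c; apply: (@le_lt_trans _ _ 1%E); last exact: ltry.
by apply: probability_le1; rewrite -[X in measurable X]setTI; exact: my'.
Qed.

End pdf_of_laplace.

Lemma cvgr_sum (R : realType) (I : Type) (r : seq I) (Q : pred I)
    (f : I -> nat -> R) (l : I -> R) :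
  (forall i, Q i -> f i m @[m --> \oo] --> l i) ->
  \sum_(i <- r | Q i) f i m @[m --> \oo] --> \sum_(i <- r | Q i) l i.
Proof.
move=> fl; elim: r => [|i r ih].
  by rewrite big_nil; under eq_fun do rewrite big_nil; exact: cvg_cst.
rewrite big_cons; under eq_fun do rewrite big_cons.
by case: ifP => // Qi; apply: cvgD => //; exact: fl.
Qed.

(** * Transition functions with prescribed rates *)

Section transition_functions.
Context {R : realType} (n : nat).
Variables (p : R -> 'M[R]_n.+1) (q : 'M[R]_n.+1).
Hypotheses (trp : transition_function p) (ratep : has_rates p q).

Let p_ge0 t i j : 0 <= t -> 0 <= p t i j.
Proof. by case: trp => h _ _ _ t0; exact: h. Qed.

Let p_sum1 t i : 0 <= t -> \sum_j p t i j = 1.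
Proof. by case: trp => _ h _ _ t0; exact: h. Qed.

Let p0 : p 0 = 1%:M.
Proof. by case: trp. Qed.

Let pD s t i j : 0 <= s -> 0 <= t -> p (s + t) i j = \sum_l p s i l * p t l j.
Proof. by case: trp => _ _ _ h s0 t0; rewrite h// mxE. Qed.

Lemma cvg_rates_harmonic (t : R) i j : 0 < t ->
  m.+1%:R * (p (t / m.+1%:R) i j - (i == j)%:R) @[m --> \oo] --> t * q i j.
Proof.
move=> t0.
rewrite (_ : (fun m => _) = (fun m => t * ((p (t / m.+1%:R) i j - (i == j)%:R) / (t / m.+1%:R)))); last first.
  apply/funext => m; rewrite invf_div [(_ - _) * _]mulrC mulrA [t * (_ / _)]mulrCA.
  by rewrite divff ?lt0r_neq0// mulr1.
apply: cvgMr; have h := @ratep i j.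
apply: (@cvg_comp _ _ _ (fun m : nat => t / m.+1%:R)
  (fun h => (p h i j - (i == j)%:R) / h) _ (0^'+) _ _ h).
move=> A [e /= e0 eA]; near=> m; apply: eA => /=; last by rewrite divr_gt0.
rewrite sub0r normrN gtr0_norm ?divr_gt0//; near: m.
have : t * harmonic m @[m --> \oo] --> (0 : R).
  by rewrite -[X in _ --> X](mulr0 t); apply: cvgMr; exact: cvg_harmonic.
move/cvgrPdist_lt/(_ _ e0); apply: filterS => m.
by rewrite sub0r normrN gtr0_norm ?mulr_gt0 ?invr_gt0.
Unshelve. all: end_near. Qed.

Lemma cvg_rate0 (t : R) i j : 0 < t -> i != j -> q i j = 0 ->
  m.+1%:R * p (t / m.+1%:R) i j @[m --> \oo] --> (0 : R).
Proof.
move=> t0 ij qij; have := @cvg_rates_harmonic t i j t0.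
by rewrite qij mulr0 (negbTE ij); under eq_fun do rewrite subr0.
Qed.

Section crossing.
Variable c : nat.
Hypothesis q0 : forall i j : 'I_n.+1, (i <= c < j)%N -> q i j = 0.

Let crossing_le t (e : R) :=
  forall i : 'I_n.+1, (i <= c)%N -> \sum_(j : 'I_n.+1 | (c < j)%N) p t i j <= e.

(** Split on the state at time [s]: either it is already above [c], with probability at most [e1],
    or the crossing remains to be made from a state at most [c], with probability at most [e2]. *)
Let crossing_leD s t e1 e2 : 0 <= s -> 0 <= t -> 0 <= e2 ->
  crossing_le s e1 -> crossing_le t e2 -> crossing_le (s + t) (e1 + e2).
Proof.
move=> s0 t0 e20 h1 h2 i ic.
rewrite (eq_bigr (fun j => \sum_l p s i l * p t l j)); last by move=> j _; exact: pD.
rewrite exchange_big/= (bigID (fun l : 'I_n.+1 => (c < l)%N))/= lerD//.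
  apply: le_trans (h1 i ic); apply: ler_sum => l _.
  rewrite -mulr_sumr ler_piMr ?p_ge0// -(p_sum1 l t0).
  rewrite [leRHS](bigID (fun j : 'I_n.+1 => (c < j)%N))/= lerDl sumr_ge0// => j _.
  exact: p_ge0.
apply: (@le_trans _ _ (\sum_(l : 'I_n.+1 | ~~ (c < l)%N) p s i l * e2)).
  apply: ler_sum => l; rewrite -leqNgt => lc.
  by rewrite -mulr_sumr ler_wpM2l ?p_ge0// h2.
rewrite -mulr_suml ler_piMl// -(p_sum1 i s0).
rewrite [leRHS](bigID (fun j : 'I_n.+1 => (c < j)%N))/= lerDr sumr_ge0// => j _.
exact: p_ge0.
Qed.

Let crossing_leMn t e m : 0 <= t -> 0 <= e -> crossing_le t e ->
  crossing_le (m%:R * t) (m%:R * e).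
Proof.
move=> t0 e0 h; elim: m => [|m ih].
  rewrite !mul0r => i ic; rewrite big1// => j cj; rewrite p0 mxE.
  by rewrite -val_eqE/= ltn_eqF// (leq_ltn_trans ic).
rewrite -natr1 !mulrDl !mul1r; apply: crossing_leD => //; exact: mulr_ge0.
Qed.

(** Cutting [[0, t]] into [m + 1] equal steps bounds the crossing probability by [m + 1] times that
    of one step, which tends to 0 because every rate across [c] vanishes. *)
Lemma transition_crossing0 t (i j : 'I_n.+1) : 0 <= t -> (i <= c < j)%N -> p t i j = 0.
Proof.
move=> t0 /andP[ic cj]; move: t0; rewrite le_eqVlt => /predU1P[<-|t0].
  by rewrite p0 mxE -val_eqE/= ltn_eqF// (leq_ltn_trans ic).
(* Summing over all starting states gives a bound uniform in the start, as iterating over the steps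
   requires. *)
pose del (m : nat) : R := \sum_(a : 'I_n.+1 | (a <= c)%N)
  \sum_(b : 'I_n.+1 | (c < b)%N) m.+1%:R * p (t / m.+1%:R) a b.
have cdel : del m @[m --> \oo] --> (0 : R).
  rewrite [X in _ --> X](_ : _ = \sum_(a : 'I_n.+1 | (a <= c)%N)
    \sum_(b : 'I_n.+1 | (c < b)%N) (0 : R)); last first.
    by rewrite big1// => a _; rewrite big1.
  apply: cvgr_sum => a ac; apply: cvgr_sum => b cb.
  apply: cvg_rate0 => //; last by apply: q0; rewrite ac.
  by rewrite -val_eqE/= ltn_eqF// (leq_ltn_trans ac).
have le m : p t i j <= del m.
  have tm0 : 0 <= t / m.+1%:R by rewrite divr_ge0// ltW.
  have h : crossing_le (t / m.+1%:R) (m.+1%:R^-1 * del m).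
    move=> a ac; rewrite ler_pdivlMl// /del mulr_sumr [leRHS](bigD1 a)//=.
    rewrite lerDl sumr_ge0// => l _; rewrite sumr_ge0// => b _.
    by rewrite mulr_ge0// p_ge0.
  have d0 : 0 <= m.+1%:R^-1 * del m.
    rewrite mulr_ge0// sumr_ge0// => a _; rewrite sumr_ge0// => b _.
    by rewrite mulr_ge0// p_ge0.
  have := crossing_leMn m.+1 tm0 d0 h; rewrite mulVKf// mulrC divfK// => /(_ i ic).
  apply: le_trans; rewrite (bigD1 j)//= lerDl sumr_ge0// => l _.
  by rewrite p_ge0// ltW.
apply/eqP; rewrite eq_le p_ge0 ?(ltW t0)// andbT.
by rewrite -(cvg_lim _ cdel)//; apply: limr_ge; [apply/cvg_ex; eexists; exact: cdel|exact: nearW].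
Qed.

End crossing.

Section triangular.
Hypothesis q_upper0 : forall i j : 'I_n.+1, (i < j)%N -> q i j = 0.

Lemma transition_upper0 t (i j : 'I_n.+1) : 0 <= t -> (i < j)%N -> p t i j = 0.
Proof.
move=> t0 ij; apply: (@transition_crossing0 i) => //; last by rewrite leqnn.
by move=> a b /andP[ai ib]; apply: q_upper0; exact: leq_ltn_trans ib.
Qed.

(** A detour from [i] back to [i] through another state would have one upward leg, of probability
    0. *)
Let diagD s t i : 0 <= s -> 0 <= t -> p (s + t) i i = p s i i * p t i i.
Proof.
move=> s0 t0; rewrite pD// (bigD1 i)//= big1 ?addr0// => l li.
have [il|il] := ltnP i l; first by rewrite (transition_upper0 s0 il) mul0r.
rewrite (@transition_upper0 t l i) ?mulr0//.
by rewrite ltn_neqAle il andbT val_eqE.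
Qed.

Let diagMn t i m : 0 <= t -> p (m%:R * t) i i = p t i i ^+ m.
Proof.
move=> t0; elim: m => [|m ih]; first by rewrite mul0r p0 mxE eqxx expr0.
by rewrite -natr1 mulrDl mul1r diagD ?mulr_ge0// ih exprSr.
Qed.

(** By multiplicativity [p t i i] is [g m ^ (m + 1)], where [g m] belongs to the step [t / (m + 1)].
    It is squeezed by [1 + x <= expR x], used at [g m - 1] for the upper bound and at [1 / g m - 1]
    for the lower one; both exponents tend to [t * q i i]. *)
Lemma transition_diag t i : 0 <= t -> p t i i = expR (t * q i i).
Proof.
rewrite le_eqVlt => /predU1P[<-|t0]; first by rewrite p0 mxE eqxx mul0r expR0.
pose g m : R := p (t / m.+1%:R) i i.
have gE m : p t i i = g m ^+ m.+1.
  by rewrite /g -diagMn ?divr_ge0 ?(ltW t0)// mulrC divfK.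
pose x m : R := m.+1%:R * (g m - 1).
have cx : x m @[m --> \oo] --> t * q i i.
  by have := @cvg_rates_harmonic t i i t0; rewrite eqxx.
have cg : g m @[m --> \oo] --> (1 : R).
  rewrite (_ : g = fun m => 1 + x m * harmonic m); last first.
    by apply/funext => m; rewrite /x/= mulrC mulKf// addrC subrK.
  rewrite -[X in _ --> X]addr0 -(mulr0 (t * q i i)).
  by apply: cvgD; [exact: cvg_cst|apply: cvgM => //; exact: cvg_harmonic].
apply/eqP; rewrite eq_le; apply/andP; split.
  have ce : expR (x m) @[m --> \oo] --> expR (t * q i i).
    by apply: continuous_cvg => //; exact: continuous_expR.
  rewrite -(cvg_lim _ ce)//; apply: limr_ge.
    by apply/cvg_ex; eexists; exact: ce.
  apply: nearW => m; rewrite (gE m) /x expRM_natl lerXn2r ?nnegrE ?expR_ge0//.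
    by rewrite p_ge0// divr_ge0// ltW.
  by apply: le_trans (expR_ge1Dx _); rewrite addrC subrK.
have ce : expR (x m / g m) @[m --> \oo] --> expR (t * q i i).
  apply: continuous_cvg; first exact: continuous_expR.
  rewrite (_ : t * q i i = t * q i i * 1^-1); last by rewrite invr1 mulr1.
  by apply: cvgM => //; apply: cvgV.
rewrite -(cvg_lim _ ce)//; apply: limr_le; first by apply/cvg_ex; eexists; exact: ce.
near=> m; have g0 : 0 < g m.
  near: m; move/cvgrPdist_lt : cg => /(_ 1 ltr01); apply: filterS => m.
  by rewrite ltr_norml => /andP[_]; rewrite ltrBlDr ltrDl.
rewrite (gE m) /x -mulrA expRM_natl lerXn2r ?nnegrE ?expR_ge0 ?(ltW g0)//.
have -> : (g m - 1) / g m = - ((g m)^-1 - 1) by field; rewrite gt_eqF.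
rewrite expRN -[leRHS]invrK lef_pV2 ?posrE ?expR_gt0 ?invr_gt0//.
by apply: le_trans (expR_ge1Dx _); rewrite addrC subrK.
Unshelve. all: end_near. Qed.

End triangular.
End transition_functions.

(** * Right-constant paths and time change *)

Section dyadic.
Context {R : realType}.
Implicit Types (s t e : R).

Definition dyadic (N j : nat) : R := j%:R / 2 ^+ N.

Lemma dyadic_ge0 N j : 0 <= dyadic N j.
Proof. by rewrite divr_ge0// exprn_ge0. Qed.

Lemma dyadic0 N : dyadic N 0 = 0.
Proof. by rewrite /dyadic mul0r. Qed.

Lemma dyadicS N j : dyadic N j.+1 = dyadic N j + (2 ^+ N)^-1.
Proof. by rewrite /dyadic -natr1 mulrDl mul1r. Qed.

Lemma le_dyadic N i j : (i <= j)%N -> dyadic N i <= dyadic N j.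
Proof. by move=> ij; rewrite ler_pM2r ?invr_gt0 ?exprn_gt0// ler_nat. Qed.

Lemma dyadic_refine N j : dyadic N j = dyadic N.+1 (2 * j).
Proof.
rewrite /dyadic natrM exprS invfM mulrACA mulfV ?mul1r//.
Qed.

Lemma expV2_lt e : 0 < e ->
  exists N0 : nat, forall N, (N0 <= N)%N -> (2 ^+ N)^-1 < e.
Proof.
move=> e0; exists (Num.bound e^-1) => N h.
rewrite invf_plt ?posrE ?exprn_gt0//; apply: lt_le_trans (archi_boundP _) _.
  by rewrite invr_ge0 ltW.
by rewrite -natrX ler_nat (leq_trans h)// ltnW// ltn_expl.
Qed.

(** For [t >= 0], the least grid time strictly above [t]: the right-hand approximation along which
    paths are sampled. *)
Definition dyadic_above (N : nat) t : R := dyadic N (Num.truncn (t * 2 ^+ N)).+1.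

Lemma dyadic_above_gt N t : t < dyadic_above N t.
Proof.
rewrite /dyadic_above /dyadic ltr_pdivlMr ?exprn_gt0//.
by apply: real_truncnS_gt; rewrite num_real.
Qed.

Lemma dyadic_above_le N t : 0 <= t -> dyadic_above N t <= t + (2 ^+ N)^-1.
Proof.
move=> t0; rewrite /dyadic_above dyadicS lerD2r /dyadic ler_pdivrMr ?exprn_gt0//.
by have /andP[] := truncn_itv (mulr_ge0 t0 (exprn_ge0 N (ler0n R 2))).
Qed.

End dyadic.

Section right_constant_paths.
Context {R : realType}.
Implicit Types (m : R -> nat) (s t e : R).

(** Right continuity into a discrete space, spelled out as a positive time without change. *)
Definition right_constant m := forall t, 0 <= t ->
  exists2 e, 0 < e & forall s, t <= s -> s < t + e -> m s = m t.

Lemma right_constant_above m t : right_constant m -> 0 <= t ->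
  exists N0 : nat, forall N, (N0 <= N)%N -> m (dyadic_above N t) = m t.
Proof.
move=> rm t0; have [e e0 h] := rm t t0; have [N0 hN] := expV2_lt e0.
exists N0 => N /hN Ne; apply: h; first exact/ltW/dyadic_above_gt.
by apply: le_lt_trans (dyadic_above_le _ t0) _; rewrite ltrD2l.
Qed.

Lemma right_continuous_constant m :
  (forall t, 0 <= t -> m s @[s --> t^'+] --> m t) -> right_constant m.
Proof.
move=> h t t0; have : \forall s \near t^'+, m s = m t.
  by apply: (h t t0 [set m t]); apply: (@discrete_set1 nat).
move=> [e /= e0 he]; exists e => // s; rewrite le_eqVlt => /predU1P[<-//|ts] se.
by apply: he => //=; rewrite ltr0_norm ?subr_lt0// opprB ltrBlDl.
Qed.

(** Reduces monotonicity to countably many pairs of times, hence to countably many null events. *)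
Lemma right_constant_nonincreasing m : right_constant m ->
  (forall N i j, (i <= j)%N -> (m (dyadic N j) <= m (dyadic N i))%N) ->
  forall s t, 0 <= s -> s <= t -> (m t <= m s)%N.
Proof.
move=> rm hm s t s0 st; have t0 := le_trans s0 st.
have [N1 h1] := right_constant_above rm s0; have [N2 h2] := right_constant_above rm t0.
rewrite -(h1 (maxn N1 N2)) ?leq_maxl// -(h2 (maxn N1 N2)) ?leq_maxr//.
apply: hm; rewrite ltnS le_truncn// ler_wpM2r// exprn_ge0//.
Qed.

End right_constant_paths.

Section inverse_process.
Context {R : realType} (T : Type).

Lemma inverse_process_ge0 (S : R -> T -> R) t w : 0 <= inverse_process S t w.
Proof.
have [E0|/set0P ne0] := eqVneq [set x | 0 <= x /\ t < S x w] set0.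
  by rewrite /inverse_process E0 inf0.
by apply: lb_le_inf => // x [].
Qed.

End inverse_process.

Section path_measurability.
Context {R : realType} d (T : measurableType d).
Implicit Types (M : R -> T -> nat) (S : R -> T -> R) (tau : T -> R).

Lemma measurable_fun_nat (f : T -> nat) :
  (forall j, measurable [set w | f w = j]) -> measurable_fun [set: T] f.
Proof.
move=> h _ Y _; rewrite setTI.
rewrite (_ : f @^-1` Y = \bigcup_(j in Y) [set w | f w = j]).
  by apply: bigcup_measurable => j _; exact: h.
by apply/seteqP; split => [w fw|w [j Yj /= fwj]]; [exists (f w)|rewrite /= fwj].
Qed.

Lemma measurable_nat_eq (f : T -> nat) j :
  measurable_fun [set: T] f -> measurable [set w | f w = j].
Proof. by move=> mf; rewrite -[X in measurable X]setTI; exact: (mf _ [set j]). Qed.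

(** [M (tau w) w] is the eventual value of [M] at the dyadic times just above [tau w], and on each
    grid these times take countably many values. *)
Lemma measurable_process_at M tau :
  (forall t, 0 <= t -> measurable_fun [set: T] (M t)) ->
  (forall w, right_constant (M ^~ w)) ->
  measurable_fun [set: T] tau -> (forall w, 0 <= tau w) ->
  measurable_fun [set: T] (fun w => M (tau w) w).
Proof.
move=> mM rM mtau tau0; apply: measurable_fun_nat => j.
pose A N i := [set w | i%:R <= tau w * 2 ^+ N < i.+1%:R].
have mA N i : measurable (A N i).
  have mt : measurable_fun [set: T] (fun w => tau w * 2 ^+ N).
    exact: measurable_funM.
  have := mt measurableT _ (measurable_itv `[i%:R, i.+1%:R[); rewrite setTI.
  by congr (measurable _); apply/seteqP; split => w /=; rewrite in_itv.
rewrite (_ : [set w | _] = \bigcup_N0 \bigcap_(N in [set N | (N0 <= N)%N])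
    \bigcup_i (A N i `&` [set w | M (dyadic N i.+1) w = j])).
  apply: bigcupT_measurable => N0; apply: bigcap_measurable => [|N _].
    by exists N0 => /=.
  apply: bigcupT_measurable => i; apply: measurableI => //.
  by apply: measurable_nat_eq; apply: mM; exact: dyadic_ge0.
have AE N w : A N (Num.truncn (tau w * 2 ^+ N)) w.
  by apply: truncn_itv; rewrite mulr_ge0// exprn_ge0.
apply/seteqP; split => w /=.
  move=> Mj; have [N0 h] := right_constant_above (rM w) (tau0 w).
  exists N0 => // N /= /h MN; exists (Num.truncn (tau w * 2 ^+ N)) => //.
  by split; [exact: AE|rewrite /= -Mj -MN].
move=> [N0 _ h]; have [N1 h1] := right_constant_above (rM w) (tau0 w).
have [i _ [Ai /= <-]] := h (maxn N0 N1) (leq_maxl _ _).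
rewrite -(h1 (maxn N0 N1)) ?leq_maxr// /dyadic_above.
by rewrite (truncn_def Ai).
Qed.

Lemma measurable_fun_lt (f : T -> R) :
  (forall r : R, measurable [set w | f w < r]) -> measurable_fun [set: T] f.
Proof.
move=> h; apply: (measurability _ (RGenCInfty.measurableE R)) => //.
move=> _ [_ [r ->] <-]; rewrite setTI.
rewrite (_ : f @^-1` _ = ~` [set w | f w < r]); first exact: measurableC.
by apply/seteqP; split => w /=; rewrite in_itv/= andbT leNgt => /negP.
Qed.

(** For [c > 0] the inverse is below [c] if [S] exceeds [t] at a dyadic time before [c], or if [S]
    never exceeds [t], in which case the infimum is taken over the empty set and equals 0. *)
Lemma measurable_inverse_process S t :
  (forall x, 0 <= x -> measurable_fun [set: T] (S x)) ->
  (forall w x y, 0 <= x -> x <= y -> S x w <= S y w) ->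
  measurable_fun [set: T] (inverse_process S t).
Proof.
move=> mS ndS; apply: measurable_fun_lt => c.
pose gt x := [set w | t < S x w]; pose le x := [set w | S x w <= t].
have mgt x : 0 <= x -> measurable (gt x).
  move=> x0; have := mS x x0 measurableT _ (measurable_itv `]t, +oo[); rewrite setTI.
  by congr (measurable _); apply/seteqP; split => w /=; rewrite in_itv/= andbT.
have mle x : 0 <= x -> measurable (le x).
  move=> x0; have := mS x x0 measurableT _ (measurable_itv `]-oo, t]); rewrite setTI.
  by congr (measurable _); apply/seteqP; split => w /=; rewrite in_itv.
have [c0|c0] := leP c 0.
  rewrite (_ : [set w | _] = set0)//; apply/seteqP; split => w //=.
  rewrite ltNge => /negP; apply; apply: (le_trans c0).
  exact: inverse_process_ge0.
rewrite (_ : [set w | _] = (\bigcup_N \bigcup_(j in [set j | dyadic N j < c]) gt (dyadic N j))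
   `|` \bigcap_(i : nat) le i%:R).
  apply: measurableU; last by apply: bigcapT_measurable => i; exact: mle.
  apply: bigcupT_measurable => N; apply: bigcup_measurable => j _; apply: mgt.
  exact: dyadic_ge0.
apply/seteqP; split => w /=.
  move=> h.
  have [E0|/set0P ne0] := eqVneq [set x | 0 <= x /\ t < S x w] set0.
    right => i _; rewrite /le/= leNgt; apply/negP => ti.
    by have : [set x | 0 <= x /\ t < S x w] i%:R by []; rewrite E0.
  left; have [x [x0 tx] xc] := inf_lt ne0 h.
  have [N0 hN] := @expV2_lt R (c - x) ltac:(by rewrite subr_gt0).
  exists N0 => //; exists (Num.truncn (x * 2 ^+ N0)).+1 => /=.
    apply: le_lt_trans (dyadic_above_le N0 x0) _.
    by rewrite -ltrBrDl hN.
  apply: (lt_le_trans tx); apply: ndS => //; exact/ltW/dyadic_above_gt.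
move=> [[N _ [j /= jc tS]]|h].
  apply: le_lt_trans jc; apply: ge_inf; first by exists 0 => x [].
  by split => //; exact: dyadic_ge0.
rewrite /inverse_process (_ : [set x | _] = set0) ?inf0//.
apply/seteqP; split => x //= [x0]; apply/negP; rewrite -leNgt.
apply: le_trans (h (Num.bound x) Logic.I); apply: ndS => //.
by apply: ltW; exact: archi_boundP.
Qed.

Lemma measurable_fun_ereal_lt (f : T -> \bar R) :
  (forall r : R, measurable [set w | (f w < r%:E)%E]) -> measurable_fun [set: T] f.
Proof.
move=> h; apply: (measurability _ (ErealGenCInfty.measurableE R)) => //.
move=> _ [_ [r ->] <-]; rewrite setTI.
rewrite (_ : f @^-1` _ = ~` [set w | (f w < r%:E)%E]); first exact: measurableC.
by apply/seteqP; split => w /=; rewrite in_itv/= andbT leNgt => /negP.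
Qed.

Lemma measurable_death_time n0 (X : R -> T -> nat) k :
  (forall t, 0 <= t -> measurable_fun [set: T] (X t)) ->
  (forall w, right_constant (X ^~ w)) ->
  measurable_fun [set: T] (death_time n0 X k).
Proof.
move=> mX rX; apply: measurable_fun_ereal_lt => r.
rewrite (_ : [set w | _] = \bigcup_N \bigcup_(j in [set j | dyadic N j < r])
    [set w | (k <= n0 - X (dyadic N j) w)%N]).
  apply: bigcupT_measurable => N; apply: bigcup_measurable => j _.
  have := mX (dyadic N j) (dyadic_ge0 _ _) measurableT [set i | (k <= n0 - i)%N] Logic.I.
  by rewrite setTI.
apply/seteqP; split => w /=.
  move=> /ereal_inf_lt[_ /= [t [t0 kt] <-]]; rewrite lte_fin => tr.
  have [N0 hN] := @expV2_lt R (r - t) ltac:(by rewrite subr_gt0).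
  have [N1 h1] := right_constant_above (rX w) t0.
  exists (maxn N0 N1) => //; exists (Num.truncn (t * 2 ^+ (maxn N0 N1))).+1 => /=.
    apply: le_lt_trans (dyadic_above_le (maxn N0 N1) t0) _.
    by rewrite -ltrBrDl hN// leq_maxl.
  by rewrite -[dyadic _ _]/(dyadic_above _ _) h1// leq_maxr.
move=> [N _ [j /= jr kj]]; apply: (@le_lt_trans _ _ (dyadic N j)%:E).
  by apply: ereal_inf_lbound => /=; exists (dyadic N j) => //; split => //; exact: dyadic_ge0.
by rewrite lte_fin.
Qed.

End path_measurability.

Section time_change.
Context {R : realType} (T : Type).

(** If [S x > t] with [x] close to the inverse [L] at [t], the inverse stays between [L] and [x] up
    to time [S x], within the interval where [M] does not change. If [S] never exceeds [t], it
    exceeds no later time either and the inverse stays 0. *)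
Lemma right_constant_time_change (M : R -> T -> nat) (S : R -> T -> R) w :
  right_constant (M ^~ w) ->
  right_constant (fun t => M (inverse_process S t w) w).
Proof.
move=> rM t t0; set L := inverse_process S t w.
have L0 : 0 <= L by exact: inverse_process_ge0.
have [e e0 he] := rM _ L0.
have [E0|/set0P ne0] := eqVneq [set x | 0 <= x /\ t < S x w] set0.
  exists 1 => // s ts _; congr (M _ w); rewrite /L /inverse_process.
  rewrite E0 (_ : [set x | _] = set0)//; apply/seteqP; split => x //= [x0 sx].
  have : [set x | 0 <= x /\ t < S x w] x by split => //; exact: le_lt_trans sx.
  by rewrite E0.
have [x [x0 tx] xL] : exists2 x, (0 <= x /\ t < S x w) & x < L + e.
  by apply: (inf_lt ne0); rewrite ltrDl.
exists (S x w - t); first by rewrite subr_gt0.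
move=> s ts; rewrite addrC subrK => sx; apply: he.
  apply: lb_le_inf; first by exists x.
  move=> y [y0 sy]; apply: ge_inf; first by exists 0 => z [].
  by split => //; exact: le_lt_trans sy.
apply: le_lt_trans xL; apply: ge_inf; first by exists 0 => z [].
by split.
Qed.

End time_change.

Section sigma_algebra_of_process.
Context {R : realType} d (T : measurableType d) d' (E : measurableType d').
Variables (D : set R) (X : R -> T -> E).
Local Notation G := (\bigcup_(t in D) preimage_set_system [set: T] (X t) measurable).

Lemma process_sigma_cylinder t (Y : set E) : D t -> measurable Y ->
  process_sigma_algebra D X (X t @^-1` Y).
Proof. by move=> Dt mY; apply: sub_sigma_algebra; exists t => //; exists Y => //; rewrite setTI. Qed.

Lemma process_sigmaC (A : set T) :
  process_sigma_algebra D X A -> process_sigma_algebra D X (~` A).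
Proof. by move=> mA; apply: (@measurableC _ (g_sigma_algebraType G)). Qed.

Lemma process_sigmaI (A B : set T) : process_sigma_algebra D X A ->
  process_sigma_algebra D X B -> process_sigma_algebra D X (A `&` B).
Proof. by move=> mA mB; apply: (@measurableI _ (g_sigma_algebraType G)). Qed.

Lemma process_sigma_bigcap (A : nat -> set T) (J : set nat) :
  (forall i, J i -> process_sigma_algebra D X (A i)) ->
  process_sigma_algebra D X (\bigcap_(i in J) A i).
Proof.
move=> mA; have [->|/set0P J0] := eqVneq J set0.
  by rewrite bigcap_set0; apply: (@measurableT _ (g_sigma_algebraType G)).
by apply: (@bigcap_measurable _ (g_sigma_algebraType G)).
Qed.

End sigma_algebra_of_process.

Section measure_finite_cover.
Context d (T : measurableType d) (R : realType) (mu : {measure set T -> \bar R}).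

Lemma measure_le_sum_cover (I : finType) (Q : pred I) (A : I -> set T) (B : set T) :
  (forall i, measurable (A i)) -> measurable B ->
  (forall x, B x -> exists2 i, Q i & A i x) ->
  (mu B <= \sum_(i | Q i) mu (A i))%E.
Proof.
move=> mA mB BA.
have h (r : seq I) : measurable (\big[setU/set0]_(i <- r | Q i) A i) /\
    (mu (\big[setU/set0]_(i <- r | Q i) A i) <= \sum_(i <- r | Q i) mu (A i))%E.
  elim: r => [|i r [mr ih]]; first by rewrite !big_nil measure0.
  rewrite !big_cons; case: ifP => // Qi; split; first exact: measurableU.
  apply: le_trans (measureU2 _ (mA i) mr) _; exact: leeD2l.
have [mU hU] := h (index_enum I); apply: le_trans hU.
apply: le_measure; rewrite ?inE// => x /BA[i Qi Ax].
by rewrite (bigD1 i)//=; left.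
Qed.

End measure_finite_cover.

(** * The sublinear death process *)

Section death_process.
Context {R : realType} d (T : measurableType d) (P : probability T R).
Variables (mu : R) (n0 : nat) (M : R -> T -> nat).
Hypothesis hM : sublinear_death_process P mu n0 M.

Lemma death_measurable t : 0 <= t -> measurable_fun [set: T] (M t).
Proof. by case: hM => -[h _ _ _ _]; exact: h. Qed.

Lemma death_measurable_eq t i : 0 <= t -> measurable [set w | M t w = i].
Proof. by move=> t0; apply: measurable_nat_eq; exact: death_measurable. Qed.

Lemma death_le t w : 0 <= t -> (M t w <= n0)%N.
Proof. by case: hM => -[_ h _ _ _]; exact: h. Qed.

Lemma death_right_constant w : right_constant (M ^~ w).
Proof. by case: hM => -[_ _ h _ _]; apply: right_continuous_constant => t; exact: h. Qed.

Lemma death_init w : M 0 w = n0.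
Proof. by case: hM. Qed.

Local Notation q := (sublinear_death_generator mu n0).

Let q_upper (i j : 'I_n0.+1) : (i < j)%N -> q i j = 0.
Proof.
move=> ij; rewrite mxE -[j == i]val_eqE/= (gtn_eqF ij) gtn_eqF ?subrr ?mulr0//.
exact: ltnW.
Qed.

Let q_skip (i j : 'I_n0.+1) : (j.+1 < i)%N -> q i j = 0.
Proof.
by move=> ij; rewrite mxE -[j == i]val_eqE/= (ltn_eqF ij) ltn_eqF ?subrr ?mulr0// ltnW.
Qed.

Let q_diag (i : 'I_n0.+1) : (0 < i)%N -> q i i = - (mu * (n0 + 1 - i)%N%:R).
Proof.
move=> i0; rewrite mxE eqxx /sublinear_death_rate (gtn_eqF i0).
by rewrite gtn_eqF// sub0r mulrN1.
Qed.

Lemma death_no_birth s t i j : 0 <= s -> 0 <= t -> (i < j <= n0)%N ->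
  P ([set w | M s w = i] `&` [set w | M (s + t) w = j]) = 0%E.
Proof.
case: hM => -[_ _ _ [p [trp ratep mk]]] _ s0 t0 /andP[ij jn].
have i1 : (i < n0.+1)%N by lia.
have j1 : (j < n0.+1)%N by lia.
have := mk s t [set: T] (Ordinal i1) (Ordinal j1) s0 t0.
rewrite setTI => ->; last first.
  by apply: (@measurableT _ (g_sigma_algebraType _)).
by rewrite (transition_upper0 trp ratep q_upper)//= mule0.
Qed.

Lemma death_hold s u i (A : set T) : 0 <= s -> 0 <= u -> (0 < i <= n0)%N ->
  process_sigma_algebra `[0, s]%classic M A ->
  P (A `&` [set w | M s w = i] `&` [set w | M (s + u) w = i]) =
  (P (A `&` [set w | M s w = i]) * (expR (- (mu * (n0 + 1 - i)%N%:R * u)))%:E)%E.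
Proof.
case: hM => -[_ _ _ [p [trp ratep mk]]] _ s0 u0 /andP[i0 jn] sA.
have i1 : (i < n0.+1)%N by lia.
rewrite (mk s u A (Ordinal i1) (Ordinal i1) s0 u0 sA).
by rewrite (transition_diag trp ratep q_upper)// q_diag//= mulrN mulrC.
Qed.

Definition jumpover (i N : nat) (l : nat) : set T :=
  [set w | (i < M (dyadic N l) w)%N] `&` [set w | (M (dyadic N l.+1) w < i)%N].

Let mjumpover i N l : measurable (jumpover i N l).
Proof.
have h (j : nat) (Y : set nat) : measurable (M (dyadic N j) @^-1` Y).
  by rewrite -[X in measurable X]setTI; exact: (death_measurable (dyadic_ge0 _ _)).
by apply: measurableI; [exact: (h _ [set x | (i < x)%N])|exact: (h _ [set x | (x < i)%N])].
Qed.

(* A jump over [i] within [0, K] shows on every dyadic grid, and the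
   probability of seeing one on the grid of step h is O(K o(h) / h). *)
Lemma death_no_skip i K :
  P (\bigcap_N \bigcup_(l in [set l | (l < K * 2 ^ N)%N]) jumpover i N l) = 0%E.
Proof.
case: hM => -[_ _ _ [p [trp ratep mk]]] _.
have mU N : measurable (\bigcup_(l in [set l | (l < K * 2 ^ N)%N]) jumpover i N l).
  by apply: bigcup_measurable.
pose skip (ab : 'I_n0.+1 * 'I_n0.+1) := (ab.2 < i < ab.1)%N.
pose h N : R := (2 ^+ N)^-1.
have h0 N : 0 < h N by rewrite invr_gt0 exprn_gt0.
pose del N : R := \sum_(ab | skip ab) K%:R * (p (h N) ab.1 ab.2 / h N).
have cdel : del N @[N --> \oo] --> (0 : R).
  rewrite [X in _ --> X](_ : _ = \sum_(ab | skip ab) (0 : R)); last by rewrite big1.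
  apply: cvgr_sum => -[a b] /andP[/= bi ia].
  rewrite -[X in _ --> X](mulr0 (K%:R)); apply: cvgMr.
  have hr := @ratep a b; rewrite q_skip in hr; last by rewrite /=; lia.
  apply: (@cvg_comp _ _ _ h (fun h => p h a b / h) _ (0^'+)).
    move=> A [e /= e0 eA]; have [N0 hN] := expV2_lt e0.
    exists N0 => // N /= /hN hNe; apply: eA => //=.
    by rewrite sub0r normrN gtr0_norm.
  move: hr; rewrite (_ : (a == b) = false); last by rewrite -val_eqE/=; lia.
  by under eq_fun do rewrite subr0.
have Ple N : (P (\bigcup_(l in [set l | (l < K * 2 ^ N)%N]) jumpover i N l) <= (del N)%:E)%E.
  have step l : (P (jumpover i N l) <= (\sum_(ab | skip ab) p (h N) ab.1 ab.2)%:E)%E.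
    apply: le_trans (_ : (\sum_(ab | skip ab) P ([set w | M (dyadic N l) w = ab.1] `&`
        [set w | M (dyadic N l.+1) w = ab.2]) <= _)%E).
      apply: measure_le_sum_cover => //.
        by move=> ab; apply: measurableI; apply: death_measurable_eq; exact: dyadic_ge0.
      move=> w [/= ia bi].
      have a1 : (M (dyadic N l) w < n0.+1)%N by rewrite ltnS death_le// dyadic_ge0.
      have b1 : (M (dyadic N l.+1) w < n0.+1)%N by rewrite ltnS death_le// dyadic_ge0.
      by exists (Ordinal a1, Ordinal b1); rewrite // /skip/= bi.
    rewrite -sumEFin; apply: lee_sum => -[a b] _ /=.
    have := mk (dyadic N l) (h N) [set: T] a b (dyadic_ge0 _ _) (ltW (h0 N)).
    rewrite setTI -dyadicS => ->; last by apply: (@measurableT _ (g_sigma_algebraType _)).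
    have p0 : 0 <= p (h N) a b by case: trp => + _ _ _; apply; exact: ltW.
    rewrite -[leRHS]mul1e; apply: lee_wpmul2r; rewrite ?lee_fin//.
    by apply: probability_le1; apply: death_measurable_eq; exact: dyadic_ge0.
  apply: le_trans (_ : (\sum_(l < K * 2 ^ N) P (jumpover i N l) <= _)%E).
    apply: measure_le_sum_cover => //.
    by move=> w [l /= lK Jw]; exists (Ordinal lK).
  apply: (@le_trans _ _ (\sum_(l < K * 2 ^ N) (\sum_(ab | skip ab) p (h N) ab.1 ab.2)%:E)%E).
    by apply: lee_sum => l _; exact: step.
  rewrite sumEFin lee_fin sumr_const card_ord -[leLHS]mulr_natl /del -mulr_sumr -mulr_suml.
  by rewrite natrM -mulrA natrX /h invrK [(2 ^+ N) * _]mulrC.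
apply/eqP; rewrite -measure_le0.
have cE : (del N)%:E @[N --> \oo] --> (0%:E : \bar R) by apply: cvg_EFin; [exact: nearW|exact: cdel].
apply: (@le_trans _ _ (limn (fun N => (del N)%:E))); last by rewrite (cvg_lim _ cE).
apply: lime_ge; first by apply/cvg_ex; eexists; exact: cE.
apply: nearW => N; apply: le_trans (Ple N); apply: le_measure; rewrite ?inE//.
  by apply: bigcapT_measurable => N'; exact: mU.
exact: bigcap_inf.
Qed.

End death_process.

(** * First passages of nonincreasing paths *)

Section first_passage.
Context {R : realType}.
Variables (m : R -> nat).
Hypothesis rm : right_constant m.
Hypothesis dm : forall s t, 0 <= s -> s <= t -> (m t <= m s)%N.

Definition first_passage (c : nat) : R := inf [set t | 0 <= t /\ (m t <= c)%N].

Lemma first_passage_ge0 c : 0 <= first_passage c.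
Proof.
have [E0|/set0P ne0] := eqVneq [set t : R | 0 <= t /\ (m t <= c)%N] set0.
  by rewrite /first_passage E0 inf0.
by apply: lb_le_inf => // t [].
Qed.

(** Right constancy makes the infimum attained. The level must be reached, since otherwise the
    infimum is 0 by convention. *)
Lemma first_passageP c t : (exists2 s, 0 <= s & (m s <= c)%N) -> 0 <= t ->
  (m t <= c)%N <-> first_passage c <= t.
Proof.
move=> [s s0 sc] t0; split=> [tc|].
  by apply: ge_inf => //; exists 0 => x [].
move=> ct; have p0 := first_passage_ge0 c; apply: leq_trans (dm p0 ct) _.
have [e e0 he] := rm p0.
have [x [x0 xc] xe] : exists2 x, (0 <= x /\ (m x <= c)%N) & x < first_passage c + e.
  by apply: inf_lt; [exists s|rewrite ltrDl].
by rewrite -(he x)//; apply: ge_inf; first by exists 0 => y [].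
Qed.

(** Expresses a sojourn in [c.+1] longer than [u] by countably many events at pairs of fixed times,
    which the Markov property can handle. A dyadic time just above the passage is a witness, the
    path being constant to the right of [t] and of [t + u]. *)
Lemma first_passage_stay c u : 0 <= u -> (exists2 s, 0 <= s & (m s <= c)%N) ->
  (exists N j, m (dyadic N j) = c.+1 /\ m (dyadic N j + u) = c.+1) <->
  first_passage c.+1 + u < first_passage c.
Proof.
move=> u0 [s s0 sc].
have ex1 : exists2 s, 0 <= s & (m s <= c.+1)%N by exists s => //; exact: leqW.
have ex0 : exists2 s, 0 <= s & (m s <= c)%N by exists s.
set t := first_passage c.+1; have t0 : 0 <= t by exact: first_passage_ge0.
split=> [[N [j [h1 h2]]]|h].
  have d0 : 0 <= dyadic N j :> R by exact: dyadic_ge0.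
  have : t <= dyadic N j by apply/(first_passageP ex1 d0); rewrite h1.
  move=> td; apply: le_lt_trans (_ : dyadic N j + u < _); first by rewrite lerD2r.
  rewrite ltNge; apply/negP => /(first_passageP ex0 (addr_ge0 d0 u0)).
  by rewrite h2 ltnn.
have tu0 : 0 <= t + u by rewrite addr_ge0.
have m1 : (m t <= c.+1)%N by apply/(first_passageP ex1 t0).
have m2 : (c < m (t + u))%N.
  by rewrite ltnNge; apply/negP => /(first_passageP ex0 tu0); rewrite leNgt h.
have m21 : (m (t + u) <= m t)%N by apply: dm => //; rewrite lerDl.
have mt : m t = c.+1 by lia.
have mtu : m (t + u) = c.+1 by lia.
have [N1 h1] := right_constant_above rm t0; have [e e0 he] := rm tu0.
have [N2 h2] := expV2_lt e0.
exists (maxn N1 N2), (Num.truncn (t * 2 ^+ (maxn N1 N2))).+1.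
rewrite -[dyadic _ _]/(dyadic_above (maxn N1 N2) t) h1 ?leq_maxl//; split => //.
rewrite he//; first by rewrite lerD2r ltW// dyadic_above_gt.
rewrite addrAC ltrD2r; apply: le_lt_trans (dyadic_above_le _ t0) _.
by rewrite ltrD2l h2// leq_maxr.
Qed.

End first_passage.

(** * Sojourn times and visits of the death process *)

Section death_sojourn.
Context {R : realType} d (T : measurableType d) (P : probability T R).
Variables (mu : R) (n0 : nat) (M : R -> T -> nat).
Hypotheses (mu0 : 0 < mu) (hM : sublinear_death_process P mu n0 M).

(** For each pair of dyadic times of one grid and each pair of states, an increase is a null
    event. *)
Lemma death_nonincreasing : {ae P, forall w, forall s t, 0 <= s -> s <= t ->
  (M t w <= M s w)%N}.
Proof.
have h : {ae P, forall w, forall N i j a b, (i <= j)%N -> (a < b <= n0)%N ->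
    ~ (M (dyadic N i) w = a /\ M (dyadic N j) w = b)}.
  apply/ae_foralln => N; apply/ae_foralln => i; apply/ae_foralln => j.
  apply/ae_foralln => a; apply/ae_foralln => b.
  have [ij|ij] := leqP i j; last by exact: aeW.
  have [ab|ab] := boolP (a < b <= n0)%N; last by exact: aeW.
  have dij0 : 0 <= dyadic N j - dyadic N i :> R by rewrite subr_ge0 le_dyadic.
  have mE := fun t (t0 : 0 <= t) c => @death_measurable_eq _ _ _ _ _ _ _ hM t c t0.
  exists ([set w | M (dyadic N i) w = a] `&` [set w | M (dyadic N j) w = b]); split.
  - by apply: measurableI; apply: mE; exact: dyadic_ge0.
  - have := death_no_birth hM (dyadic_ge0 N i) dij0 ab.
    by rewrite addrC subrK.
  - by move=> w /= hw; apply: contrapT => nw; apply: hw => _ _ h; exact: nw.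
apply: filterS h => w hw; apply: (right_constant_nonincreasing (death_right_constant hM w)).
move=> N i j ij; rewrite leqNgt; apply/negP => lt.
by apply: (hw N i j _ _ ij _ (conj erefl erefl)); rewrite lt (death_le hM)// dyadic_ge0.
Qed.

Section state.
Variables (i : nat) (i0 : (0 < i <= n0)%N).
Let lam : R := mu * (n0 + 1 - i)%N%:R.

Let lam0 : 0 < lam.
Proof. by rewrite mulr_gt0// ltr0n; lia. Qed.

Definition death_stays (u : R) : set T := \bigcup_N \bigcup_j
  ([set w | M (dyadic N j) w = i] `&` [set w | M (dyadic N j + u) w = i]).

Let visitN N : set T := \bigcup_j [set w | M (dyadic N j) w = i].
Let staysN u N : set T := \bigcup_j
  ([set w | M (dyadic N j) w = i] `&` [set w | M (dyadic N j + u) w = i]).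
Let before N j : set T :=
  \bigcap_(l in [set l | (l < j)%N]) ~` [set w | M (dyadic N l) w = i].

Let mE t : 0 <= t -> measurable [set w | M t w = i].
Proof. exact: (death_measurable_eq hM). Qed.

Let mdE N j u : 0 <= u -> measurable [set w | M (dyadic N j + u) w = i].
Proof. by move=> u0; apply: mE; rewrite addr_ge0// dyadic_ge0. Qed.

Let mvisitN N : measurable (visitN N).
Proof. by apply: bigcupT_measurable => j; apply: mE; exact: dyadic_ge0. Qed.

Let mstaysN u N : 0 <= u -> measurable (staysN u N).
Proof.
move=> u0; apply: bigcupT_measurable => j.
by apply: measurableI; [apply: mE; exact: dyadic_ge0|exact: mdE].
Qed.

Lemma measurable_death_stays u : 0 <= u -> measurable (death_stays u).
Proof. by move=> u0; apply: bigcupT_measurable => N; exact: mstaysN. Qed.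

Let sigma_before N j : process_sigma_algebra `[0, dyadic N j]%classic M (before N j).
Proof.
apply: process_sigma_bigcap => l /= lj; apply: process_sigmaC.
apply: (@process_sigma_cylinder R _ T _ nat _ M (dyadic N l) [set i]) => //=.
by rewrite in_itv/= dyadic_ge0/= le_dyadic// ltnW.
Qed.

Let mbefore N j : measurable (before N j).
Proof.
have [->|j0] := eqVneq j 0%N.
  rewrite /before (_ : [set l | _] = set0) ?bigcap_set0//.
  by apply/seteqP; split.
apply: bigcap_measurable; first by exists 0%N; rewrite /= lt0n.
by move=> l _; apply: measurableC; apply: mE; exact: dyadic_ge0.
Qed.

(** Sorting visits by the first index on the grid makes the events disjoint, and [before N j] lies
    in the past of [dyadic N j], as [death_hold] demands. *)
Let first N j : set T := before N j `&` [set w | M (dyadic N j) w = i].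

Let triv_first N (F : nat -> set T) : trivIset setT (fun j => first N j `&` F j).
Proof.
apply/trivIsetP => j l _ _; wlog jl : j l / (j < l)%N.
  move=> wl; rewrite neq_ltn => /orP[h|h]; first by apply: wl; rewrite ?ltn_eqF.
  by rewrite setIC; apply: wl => //; rewrite ltn_eqF.
move=> _; apply/seteqP; split => // w [[[_ /= wj] _] [[bl _] _]].
exact: (bl j jl).
Qed.

Let visitN_first N : visitN N = \bigcup_j first N j.
Proof.
apply/seteqP; split => w [j _ /= h]; last by exists j => //; case: h.
have ex : exists j, M (dyadic N j) w == i by exists j; apply/eqP.
case: (ex_minnP ex) => l /eqP ml hl; exists l => //; split => // a /= al.
by move=> /eqP /hl; rewrite leqNgt al.
Qed.

Let P_first N u : 0 <= u ->
  P (\bigcup_j (first N j `&` [set w | M (dyadic N j + u) w = i])) =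
  (P (visitN N) * (expR (- (lam * u)))%:E)%E.
Proof.
move=> u0.
have mf j : measurable (first N j) by apply: measurableI => //; apply: mE; exact: dyadic_ge0.
have ms j : measurable (first N j `&` [set w | M (dyadic N j + u) w = i]).
  by apply: measurableI => //; exact: mdE.
rewrite (measure_semi_bigcup P ms (@triv_first N _) (bigcupT_measurable _ ms)).
have tf : trivIset setT (first N).
  by have := @triv_first N (fun=> setT); under eq_fun do rewrite setIT.
rewrite visitN_first (measure_semi_bigcup P mf tf (bigcupT_measurable _ mf)).
rewrite muleC -nneseriesZl//.
apply: eq_eseriesr => j _; rewrite [RHS]muleC.
exact: (death_hold hM (dyadic_ge0 N j) u0 i0 (@sigma_before N j)).
Qed.

(** On a monotone path, a stay of length [u] counted from any grid visit entails one from the first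
    grid visit, so [P_first] applies. *)
Let P_staysN N u : 0 <= u -> P (staysN u N) = (P (visitN N) * (expR (- (lam * u)))%:E)%E.
Proof.
move=> u0; rewrite -P_first//; apply: ae_eq_measure.
- exact: mstaysN.
- apply: bigcupT_measurable => j; apply: measurableI; last exact: mdE.
  by apply: measurableI => //; apply: mE; exact: dyadic_ge0.
apply: filterS death_nonincreasing => w mono; split; last first.
  by move=> [j _ [[_ /= h1] /= h2]]; exists j.
move=> [j _ [/= h1 h2]].
have ex : exists j, M (dyadic N j) w == i by exists j; apply/eqP.
case: (ex_minnP ex) => l /eqP ml hl; exists l => //; split.
  split => // a /= al; move=> /eqP /hl; by rewrite leqNgt al.
have lj : (l <= j)%N by apply: hl; apply/eqP.
have a1 : (M (dyadic N j + u) w <= M (dyadic N l + u) w)%N.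
  by apply: mono; rewrite ?addr_ge0 ?dyadic_ge0// lerD2r le_dyadic.
have a2 : (M (dyadic N l + u) w <= M (dyadic N l) w)%N.
  by apply: mono; rewrite ?dyadic_ge0// lerDl.
by rewrite /=; lia.
Qed.

Lemma P_death_stays u : 0 <= u ->
  P (death_stays u) = (P (\bigcup_N \bigcup_j [set w | M (dyadic N j) w = i]) *
                       (expR (- (lam * u)))%:E)%E.
Proof.
move=> u0.
have c1 : P (staysN u N) @[N --> \oo] --> P (death_stays u).
  apply: nondecreasing_cvg_mu => //.
  - by move=> N; exact: mstaysN.
  - exact: measurable_death_stays.
  - apply/nondecreasing_seqP => N; apply/subsetPset => w [j _ h].
    by exists (2 * j)%N => //; rewrite -!dyadic_refine.
have c2 : P (visitN N) @[N --> \oo] --> P (\bigcup_N visitN N).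
  apply: nondecreasing_cvg_mu => //.
  - exact: bigcupT_measurable.
  - apply/nondecreasing_seqP => N; apply/subsetPset => w [j _ h].
    by exists (2 * j)%N => //=; rewrite -dyadic_refine.
apply: (cvg_unique _ c1) => //.
rewrite /= (_ : (fun N => _) = (fun N => P (visitN N) * (expR (- (lam * u)))%:E)%E).
  exact: cvgeZr.
by apply/funext => N; exact: P_staysN.
Qed.

(** A stay of length [K] has probability at most [expR (- (lam * K))], hence staying for every [K]
    is a null event; a monotone path that has visited [i] and does not stay must then be below
    [i]. *)
Lemma death_leaves : {ae P, forall w, exists N j, M (dyadic N j) w = i} ->
  {ae P, forall w, exists K : nat, (M K%:R w < i)%N}.
Proof.
move=> vis.
have : {ae P, forall w, exists K : nat, ~ death_stays K%:R w}.
  exists (\bigcap_(K : nat) death_stays K%:R); split.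
  - by apply: bigcapT_measurable => K; exact: measurable_death_stays.
  - apply/eqP; rewrite -measure_le0.
    have cr : expR (- (lam * K%:R)) @[K --> \oo] --> (0 : R).
      rewrite (_ : (fun K : nat => _) = (fun K => expR (- lam) ^+ K)); last first.
        by apply/funext => K; rewrite -expRM_natr mulNr.
      by apply: cvg_expr; rewrite ger0_norm ?expR_ge0// expR_lt1 oppr_lt0.
    have c : (expR (- (lam * K%:R)))%:E @[K --> \oo] --> (0%:E : \bar R).
      by apply: cvg_EFin; [exact: nearW|exact: cr].
    apply: (@le_trans _ _ (limn (fun K : nat => (expR (- (lam * K%:R)))%:E : \bar R))); last first.
      by rewrite (cvg_lim _ c).
    apply: lime_ge; first by apply/cvg_ex; eexists; exact: c.
    apply: nearW => K; apply: le_trans (_ : (P (death_stays K%:R) <= _)%E).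
      apply: le_measure; rewrite ?inE//.
      + by apply: bigcapT_measurable => K'; exact: measurable_death_stays.
      + exact: measurable_death_stays.
      + exact: bigcap_inf.
    rewrite P_death_stays// -[leRHS]mul1e; apply: lee_wpmul2r.
      by rewrite lee_fin expR_ge0.
    by apply: probability_le1; exact: bigcupT_measurable.
  - move=> w /= hw K _; apply: contrapT => nK; apply: hw; by exists K.
move=> lv; apply: filterS3 death_nonincreasing vis lv => w mono [N [j vj]] [K nK].
exists (Num.bound (dyadic N j + K%:R : R)).
have dK0 : 0 <= dyadic N j + K%:R :> R by rewrite addr_ge0// dyadic_ge0.
apply: leq_ltn_trans (mono _ _ dK0 (ltW (archi_boundP dK0))) _.
have h1 : (M (dyadic N j + K%:R) w <= M (dyadic N j) w)%N.
  by apply: mono; rewrite ?dyadic_ge0// lerDl.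
rewrite ltn_neqAle -{2}vj h1 andbT; apply/eqP => h2; apply: nK.
by exists N => //; exists j.
Qed.

End state.

(** Descending induction from the initial state. If the state above [c] has been left by time [K]
    and [c] is never seen at a dyadic time, then every grid shows a jump over [c] before [K], which
    [death_no_skip] makes a null event. *)
Lemma death_visits i : (0 < i <= n0)%N ->
  {ae P, forall w, exists N j, M (dyadic N j) w = i}.
Proof.
move=> /andP[i1 iN]; have [k [kn ->]] : exists k, (k < n0)%N /\ i = (n0 - k)%N by exists (n0 - i)%N; lia.
have : (k < n0)%N -> {ae P, forall w, exists N j, M (dyadic N j) w = (n0 - k)%N}.
  elim: k {kn} => [|k ih] kn.
    by apply: aeW => w; exists 0%N, 0%N; rewrite dyadic0 (death_init hM) subn0.
  set c := (n0 - k.+1)%N; have cE : (n0 - k)%N = c.+1 by rewrite /c; lia.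
  have i2 : (0 < n0 - k <= n0)%N by lia.
  have lv := death_leaves i2 (ih (ltnW kn)).
  have ns : {ae P, forall w, forall K : nat, ~ (forall N,
      exists2 l, (l < K * 2 ^ N)%N & jumpover M c N l w)}.
    apply/ae_foralln => K; have := death_no_skip hM c K => h0.
    exists (\bigcap_N \bigcup_(l in [set l | (l < K * 2 ^ N)%N]) jumpover M c N l); split => //.
      apply: bigcapT_measurable => N; apply: bigcup_measurable => l _.
      have hY (j : nat) (Y : set nat) : measurable (M (dyadic N j) @^-1` Y).
        rewrite -[X in measurable X]setTI.
        exact: (death_measurable hM (dyadic_ge0 _ _)).
      by apply: measurableI; [exact: (hY _ [set x | (c < x)%N])|exact: (hY _ [set x | (x < c)%N])].
    by move=> w /= hw N _; apply: contrapT => nl; apply: hw => hall; apply: nl; have [l] := hall N; exists l.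
  apply: filterS2 lv ns => w [K hK] nsk; apply: contrapT => nv.
  apply: (nsk K) => N.
  have nvN l : M (dyadic N l) w <> c by move=> h; apply: nv; exists N, l.
  have ex : exists l, (M (dyadic N l) w < c)%N.
    exists (K * 2 ^ N)%N; have : M (dyadic N (K * 2 ^ N)) w <> c by exact: nvN.
    rewrite /dyadic natrM natrX mulfK ?expf_neq0//.
    by move=> ne; move: hK; rewrite cE ltnS leq_eqVlt => /orP[/eqP/ne|].
  case: (ex_minnP ex) => l hl minl.
  have l0 : (0 < l)%N.
    rewrite lt0n; apply/eqP => l0; move: hl; rewrite l0 dyadic0 (death_init hM) /c; lia.
  exists l.-1.
    rewrite (leq_trans _ (minl (K * 2 ^ N)%N _))//; first by rewrite prednK.
    have : M (dyadic N (K * 2 ^ N)) w <> c by exact: nvN.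
    rewrite /dyadic natrM natrX mulfK ?expf_neq0//.
    by move=> ne; move: hK; rewrite cE ltnS leq_eqVlt => /orP[/eqP/ne|].
  split => /=; last by rewrite prednK.
  rewrite ltn_neqAle; apply/andP; split; first by apply/eqP => h; exact: (nvN l.-1).
  by rewrite leqNgt; apply/negP => /minl; rewrite -{1}(prednK l0) ltnn.
exact.
Qed.

Lemma death_reaches : {ae P, forall w, forall c, exists2 s, 0 <= s & (M s w <= c)%N}.
Proof.
apply/ae_foralln => c; have [cn|nc] := ltnP c n0; last first.
  by apply: aeW => w; exists 0 => //; rewrite (death_init hM).
have c1 : (0 < c.+1 <= n0)%N by [].
apply: filterS (death_leaves c1 (death_visits c1)) => w [K hK].
by exists K%:R.
Qed.

Lemma P_sojourn_gt c u : (c < n0)%N -> 0 <= u ->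
  measurable [set w | first_passage (M ^~ w) c.+1 + u < first_passage (M ^~ w) c] ->
  P [set w | first_passage (M ^~ w) c.+1 + u < first_passage (M ^~ w) c] =
  (expR (- (mu * (n0 - c)%N%:R * u)))%:E.
Proof.
move=> cn u0 mS; have c1 : (0 < c.+1 <= n0)%N by [].
have := P_death_stays c1 u0.
have -> : P (\bigcup_N \bigcup_j [set w | M (dyadic N j) w = c.+1]) = 1%E.
  have mV : measurable (\bigcup_N \bigcup_j [set w | M (dyadic N j) w = c.+1]).
    apply: bigcupT_measurable => N; apply: bigcupT_measurable => j.
    by apply: (death_measurable_eq hM); exact: dyadic_ge0.
  rewrite -(@probability_setT _ _ _ P); apply: ae_eq_measure => //.
  by apply: filterS (death_visits c1) => w [N [j h]]; split => // _; exists N => //; exists j.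
rewrite mul1e (_ : (n0 + 1 - c.+1)%N = (n0 - c)%N); last by lia.
move=> <-; apply: ae_eq_measure => //; first exact: measurable_death_stays.
apply: filterS2 death_nonincreasing death_reaches => w mono reach.
have h := first_passage_stay (death_right_constant hM w) mono u0 (reach c).
split.
  by move=> /h[N [j [h1 h2]]]; exists N => //; exists j.
by move=> [N _ [j _ [h1 h2]]]; apply/h; exists N, j.
Qed.

End death_sojourn.

(** * Laplace transform of an exponential tail *)

Section exponential.
Context {R : realType}.
Local Notation leb := (@lebesgue_measure R).

Lemma continuous_within_powR (a : R) : 0 < a ->
  {within `[0, 1], continuous (@powR R ^~ a)}.
Proof.
move=> a0; apply/continuous_within_itvP => //; split.
- by move=> x; rewrite in_itv/= => /andP[x0 _]; exact: continuous_powR.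
- by rewrite powR0 ?gt_eqF//; exact: powR_cvg0.
- by apply: cvg_at_left_filter; exact: continuous_powR.
Qed.

Lemma integral_onem_powR (a : R) : 0 < a ->
  (\int[leb]_(x in `[0%R, 1%R]) ((1 - x) `^ a)%:E = (a + 1)^-1%:E)%E.
Proof.
move=> a0; have a10 : 0 < a + 1 by rewrite addr_gt0.
have := @integration_by_substitution_onem R (@powR R ^~ a) 1.
rewrite /unstable.onem subrr => <-; [|by rewrite ler01 lexx|exact: continuous_within_powR].
rewrite (@continuous_FTC2 _ _ (fun x => (a + 1)^-1 * x `^ (a + 1)))//.
- by rewrite powR0 ?gt_eqF// mulr0 powR1 mulr1 sube0.
- exact: continuous_within_powR.
- split.
  + move=> x; rewrite in_itv/= => /andP[x0 _]; apply: derivableM => //.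
    by apply: derivable_powR; rewrite in_itv/= x0.
  + rewrite powR0 ?gt_eqF//; apply: cvgMr; exact: powR_cvg0.
  + apply: cvgMr; apply: cvg_at_left_filter; exact: continuous_powR.
- move=> x; rewrite in_itv/= => /andP[x0 _].
  rewrite derive1Ml; last by apply: derivable_powR; rewrite in_itv/= x0.
  have ? := is_derive1_powR (a + 1) x0.
  by rewrite derive1E derive_val addrK mulrA mulVf ?mul1r// gt_eqF.
Qed.

Context d (T : measurableType d) (P : probability T R).

(** The law of [y] is known through its tail only, so the expectation of
    [X = 1 - expR (- (theta * y))] is computed from its own tail, [(1 - r) ^ (lam / theta)] on [[0,
    1[], whose integral is [theta / (lam + theta)]. *)
Lemma exponential_laplace (lam theta : R) (y : T -> R) :
  0 < lam -> 0 < theta -> measurable_fun [set: T] y -> (forall w, 0 <= y w) ->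
  (forall u, 0 <= u -> P [set w | u < y w] = (expR (- (lam * u)))%:E) ->
  (\int[P]_w (expR (- (theta * y w)))%:E = (lam / (lam + theta))%:E)%E.
Proof.
move=> lam0 th0 my y0 hy.
have mX : measurable_fun [set: T] (fun w => 1 - expR (- (theta * y w))).
  apply: measurable_funB => //; apply: measurableT_comp => //.
  by apply: measurableT_comp => //; exact: measurable_funM.
pose X : {RV P >-> R} := HB.pack (fun w => 1 - expR (- (theta * y w)))
  (isMeasurableFun.Build _ _ _ _ _ mX).
have E1 w : 0 <= expR (- (theta * y w)) <= 1.
  by rewrite expR_ge0/= -expR0 ler_expR oppr_le0 mulr_ge0// ltW.
have X0 w : 0 <= X w by rewrite subr_ge0; case/andP: (E1 w).
have EX : ('E_P[X] = (theta / (lam + theta))%:E)%E.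
  rewrite ge0_expectation_ccdf//.
  have cc r : 0 <= r -> ccdf X r = (if r < 1 then (1 - r) `^ (lam / theta) else 0)%:E.
    move=> r0; rewrite /ccdf /distribution /pushforward.
    have [r1|r1] := ltP r 1.
      have r1' : 0 < (1 - r) by rewrite subr_gt0.
      rewrite /powR gt_eqF//.
      have -> : lam / theta * ln (1 - r) = - (lam * (- ln (1 - r) / theta)) by field; rewrite gt_eqF.
      rewrite -hy; last first.
        by rewrite divr_ge0 ?(ltW th0)// oppr_ge0 ln_le0// gerBl.
      congr (P _); apply/seteqP; split => w /=; rewrite in_itv/= andbT ltr_pdivrMr//.
        rewrite ltrBrDl -ltrBrDr => h; rewrite -ltrNl mulrC.
        by rewrite -[ltLHS]expRK ltr_ln ?posrE ?expR_gt0.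
      rewrite -ltrNl mulrC -[ltLHS]expRK ltr_ln ?posrE ?expR_gt0// => h.
      by rewrite ltrBrDl -ltrBrDr.
    rewrite (_ : _ @^-1` _ = set0) ?measure0//; apply/seteqP; split => w //=.
    by rewrite in_itv/= andbT => h; have /andP[e0 _] := E1 w; lra.
  have -> : theta / (lam + theta) = (lam / theta + 1)^-1.
    by field; rewrite !gt_eqF// ?addr_gt0.
  rewrite -integral_onem_powR ?divr_gt0// [LHS]integral_mkcond [RHS]integral_mkcond.
  apply: eq_integral => r _; rewrite !patchE !mem_setE !in_itv/= andbT.
  have [r0|//] := leP 0 r; rewrite cc//.
  have [//|//|->] /= := ltgtP r 1.
  by rewrite subrr powR0// mulf_neq0 ?invr_eq0 ?gt_eqF.
have mE : measurable_fun [set: T] (fun w => (expR (- (theta * y w)))%:E).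
  apply/measurable_EFinP; apply: measurableT_comp => //.
  by apply: measurableT_comp => //; exact: measurable_funM.
have : (\int[P]_w ((X w)%:E + (expR (- (theta * y w)))%:E) = 1)%E.
  rewrite -(@probability_setT _ _ _ P) -(mul1e (P setT)) -integral_cst//.
  by apply: eq_integral => w _; rewrite -EFinD subrK.
rewrite ge0_integralD//; last first.
- by apply/measurable_EFinP; exact: mX.
- by move=> w _; rewrite lee_fin.
have -> : (\int[P]_w (X w)%:E = (theta / (lam + theta))%:E)%E by rewrite -EX unlock.
case: (integral _ _ _) => [r||] //.
rewrite -EFinD => -[h]; congr (_%:E).
have lt0 : lam + theta != 0 by rewrite gt_eqF// addr_gt0.
have -> : r = 1 - theta / (lam + theta) by rewrite -h addrC addKr.
by field.
Qed.

End exponential.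

Section measurable_first_passage.
Context {R : realType} d (T : measurableType d).
Implicit Types (M : R -> T -> nat).

Lemma measurable_first_passage M c :
  (forall t, 0 <= t -> measurable_fun [set: T] (M t)) ->
  (forall w, right_constant (M ^~ w)) ->
  measurable_fun [set: T] (fun w => first_passage (M ^~ w) c).
Proof.
move=> mM rM.
have mle t : 0 <= t -> measurable [set w | (M t w <= c)%N].
  by move=> t0; rewrite -[X in measurable X]setTI; exact: (mM t t0 measurableT [set n | (n <= c)%N]).
apply: measurable_fun_lt => r; have [r0|r0] := leP r 0.
  rewrite (_ : [set w | _] = set0)//; apply/seteqP; split => w //=.
  by rewrite ltNge (le_trans r0)// first_passage_ge0.
pose hit (D : nat -> set nat) := \bigcup_N \bigcup_(j in D N) [set w | (M (dyadic N j) w <= c)%N].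
have mhit D : measurable (hit D).
  apply: bigcupT_measurable => N; apply: bigcup_measurable => j _.
  exact/mle/dyadic_ge0.
have near w t : 0 <= t -> (M t w <= c)%N -> forall r, t < r ->
    exists N j, dyadic N j < r /\ (M (dyadic N j) w <= c)%N.
  move=> t0 tc r' tr; have [N1 h1] := right_constant_above (rM w) t0.
  have [N2 h2] := @expV2_lt _ (r' - t) ltac:(by rewrite subr_gt0).
  exists (maxn N1 N2), (Num.truncn (t * 2 ^+ (maxn N1 N2))).+1.
  rewrite -[dyadic _ _]/(dyadic_above _ t) h1 ?leq_maxl//; split => //.
  apply: le_lt_trans (dyadic_above_le _ t0) _.
  by rewrite -ltrBrDl h2// leq_maxr.
(* The second event collects the paths that never reach [c]; their first passage is 0 by convention,
   hence below [r]. *)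
rewrite (_ : [set w | _] = hit (fun N => [set j | dyadic N j < r]) `|` ~` hit (fun=> setT)).
  by apply: measurableU => //; exact: measurableC.
apply/seteqP; split => w /=.
  have [[N _ [j _ h]]|nh] := pselect (hit (fun=> setT) w); last by right.
  move=> /inf_lt[|t [t0 tc] tr].
    by exists (dyadic N j); split => //; exact: dyadic_ge0.
  by left; have [N' [j' [? ?]]] := near _ _ t0 tc _ tr; exists N' => //; exists j'.
case=> [[N _ [j /= jr h]]|nh].
  apply: le_lt_trans jr; apply: ge_inf; first by exists 0 => x [].
  by split => //; exact: dyadic_ge0.
rewrite /first_passage (_ : [set t | _] = set0) ?inf0//.
apply/seteqP; split => t //= [t0 tc]; apply: nh.
have [N [j [_ h]]] := near _ _ t0 tc (t + 1) ltac:(by rewrite ltrDl).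
by exists N => //; exists j.
Qed.

End measurable_first_passage.

(** * Dyadic approximation of passages from the left *)

Section left_dyadic_first_passage.
Context {R : realType}.
Implicit Types (m : R -> nat).

(* The largest dyadic of level [N] before the first passage, as soon as the
   latter is positive. *)
Definition passage_index m c N : nat :=
  get [set j | (m (dyadic N j.+1) <= c)%N /\
    forall l, (l < j)%N -> (c < m (dyadic N l.+1))%N].

Lemma passage_indexP m c N : (exists2 s, 0 <= s & (m s <= c)%N) ->
  (forall s t, 0 <= s -> s <= t -> (m t <= m s)%N) ->
  (m (dyadic N (passage_index m c N).+1) <= c)%N /\
    forall l, (l < passage_index m c N)%N -> (c < m (dyadic N l.+1))%N.
Proof.
move=> [s s0 sc] dm.
have ex : exists j, (m (dyadic N j.+1) <= c)%N.
  exists (Num.truncn (s * 2 ^+ N)); apply: leq_trans sc; apply: dm => //.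
  exact/ltW/dyadic_above_gt.
have [j hj minj] := ex_minnP ex.
have : [set j | (m (dyadic N j.+1) <= c)%N /\
    forall l, (l < j)%N -> (c < m (dyadic N l.+1))%N] j.
  by split => // l lj; rewrite ltnNge; apply/negP => /minj; rewrite leqNgt lj.
exact: getI.
Qed.

Section good_path.
Variables (m : R -> nat) (c : nat).
Hypotheses (rm : right_constant m)
  (dm : forall s t, 0 <= s -> s <= t -> (m t <= m s)%N)
  (reach : exists2 s, 0 <= s & (m s <= c)%N).

Local Notation D N := (dyadic N (passage_index m c N) : R).
Local Notation sigma := (first_passage m c).

(** The strict inequality is what leads to the left limit of [S]. The exception is genuine: when the
    passage is at time 0, as for the 0th death, no grid time precedes it. *)
Lemma passage_dyadic_lt N : D N = 0 \/ D N < sigma.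
Proof.
have [h1 h2] := passage_indexP N reach dm.
have [->|i0] := posnP (passage_index m c N); first by left; rewrite dyadic0.
right; rewrite ltNge; apply/negP => /(first_passageP rm dm reach (dyadic_ge0 _ _)).
have := h2 (passage_index m c N).-1; rewrite prednK// leqnn => /(_ isT).
by rewrite ltnNge => /negP.
Qed.

Lemma passage_dyadic_gt N : sigma <= D N + (2 ^+ N)^-1.
Proof.
have [h1 h2] := passage_indexP N reach dm.
by rewrite -dyadicS; apply/(first_passageP rm dm reach (dyadic_ge0 _ _)).
Qed.

Lemma passage_dyadic_near x : x < sigma -> \forall N \near \oo, x < D N.
Proof.
move=> xs; have [N0 h] := @expV2_lt R (sigma - x) ltac:(by rewrite subr_gt0).
near=> N; have := passage_dyadic_gt N; have := h N _.
rewrite ltrBrDl => /(_ _)/lt_le_trans H /H; rewrite ltrD2r; apply.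
by near: N; exact: nbhs_infty_ge.
Unshelve. all: by end_near. Qed.

Lemma cvg_passage_dyadic : D N @[N --> \oo] --> sigma.
Proof.
apply/cvgrPdist_lt => e e0; near=> N.
have s0 : 0 <= sigma by exact: first_passage_ge0.
have : sigma - e < D N by near: N; apply: passage_dyadic_near; rewrite ltrBlDr ltrDl.
have : D N <= sigma by have [->//|/ltW] := passage_dyadic_lt N.
by move=> h1 h2; rewrite ger0_norm ?subr_ge0// ltrBlDr -ltrBlDl.
Unshelve. all: by end_near. Qed.

End good_path.

Lemma passage_index_anti m c c' N : (c' <= c)%N ->
  (exists2 s, 0 <= s & (m s <= c')%N) ->
  (forall s t, 0 <= s -> s <= t -> (m t <= m s)%N) ->
  (passage_index m c N <= passage_index m c' N)%N.
Proof.
move=> cc r dm; have [h1 _] := passage_indexP N r dm.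
have [|_ h2] := @passage_indexP m c N _ dm.
  by case: r => s s0 h; exists s => //; exact: leq_trans cc.
rewrite leqNgt; apply/negP => /h2; rewrite ltnNge => /negP; apply.
exact: leq_trans cc.
Qed.

Section time_changed.
Context (T : Type).
Variables (S : R -> T -> R) (m : R -> nat) (n0 : nat) (w : T).
Hypotheses (rm : right_constant m)
  (dm : forall s t, 0 <= s -> s <= t -> (m t <= m s)%N)
  (m_le : forall t, 0 <= t -> (m t <= n0)%N)
  (reach : forall c, exists2 s, 0 <= s & (m s <= c)%N)
  (S0 : S 0 w = 0)
  (ndS : forall s t, 0 <= s -> s <= t -> S s w <= S t w)
  (unbS : forall K, exists2 x, 0 <= x & K < S x w).
Variable X : R -> T -> nat.
Hypothesis XE : forall t, 0 <= t -> X t w = m (inverse_process S t w).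

(* The time-changed path drops to the level [n0 - k] as soon as [S] has, on
   [0, sigma[, been exhausted, i.e. at the left limit of [S] at [sigma]. *)
Lemma death_time_time_change k : (k <= n0)%N ->
  exists2 t : R, death_time n0 X k w = t%:E &
    S (dyadic N (passage_index m (n0 - k) N)) w @[N --> \oo] --> t.
Proof.
move=> kn; set c := (n0 - k)%N; set sigma := first_passage m c.
have s0 : 0 <= sigma by exact: first_passage_ge0.
pose A : set R := [set t | 0 <= t /\ (k <= n0 - X t w)%N].
(* Only the values of [S] strictly before [sigma] enter, so [inf A] is their supremum, or 0 if
   [sigma = 0]. *)
have AE t : 0 <= t -> A t <-> forall x, 0 <= x -> x < sigma -> S x w <= t.
  move=> t0; have L0 := inverse_process_ge0 S t w.
  have -> : A t <-> sigma <= inverse_process S t w.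
    rewrite /A /= XE//; have := first_passageP rm dm (reach c) L0.
    move: (m_le L0); rewrite -/sigma /c => mle h; split.
      by move=> [_ h1]; apply/h; lia.
    by move=> /h h1; split => //; lia.
  split=> [sL x x0 xs|h].
    rewrite leNgt; apply/negP => tS.
    have : inverse_process S t w <= x by apply: ge_inf; first by exists 0 => y [].
    by rewrite leNgt (lt_le_trans xs sL).
  apply: lb_le_inf; first by have [x x0 xt] := unbS t; exists x.
  by move=> x [x0 xt]; rewrite leNgt; apply/negP => /(h x x0); rewrite leNgt xt.
have lbA : has_lbound A by exists 0 => t [].
have Ss : 0 <= S sigma w by rewrite -S0; exact: ndS.
have A0 : A !=set0 by exists (S sigma w); apply/AE => // x x0 /ltW; exact: ndS.
exists (inf A).
  by rewrite /death_time -ereal_inf_EFin.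
have infA0 : 0 <= inf A by apply: lb_le_inf => // t [].
apply/cvgrPdist_lt => e e0.
have up N : S (dyadic N (passage_index m c N)) w <= inf A.
  have [->|Ds] := passage_dyadic_lt rm dm (reach c) N; first by rewrite S0.
  apply: lb_le_inf => // t At; have t0 : 0 <= t by case: At.
  by have /(AE _ t0) := At; apply => //; exact: dyadic_ge0.
have lo : \forall N \near \oo, inf A - e < S (dyadic N (passage_index m c N)) w.
  have [e1|e1] := ltP (inf A - e) 0.
    apply: nearW => N; apply: (lt_le_trans e1); rewrite -S0; apply: ndS => //.
    exact: dyadic_ge0.
  have nA : ~ A (inf A - e).
    by move=> /(ge_inf lbA); rewrite leNgt ltrBlDr ltrDl e0.
  have [x [x0 xs xS]] : exists x, [/\ 0 <= x, x < sigma & inf A - e < S x w].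
    apply: contrapT => nx; apply: nA; apply/AE => // x x0 xs.
    by rewrite leNgt; apply/negP => h; apply: nx; exists x.
  near=> N; apply: (lt_le_trans xS); apply: ndS => //; apply: ltW.
  by near: N; exact: passage_dyadic_near.
near=> N; rewrite ger0_norm ?subr_ge0// ltrBlDr -ltrBlDl.
by near: N.
Unshelve. all: by end_near. Qed.

End time_changed.
End left_dyadic_first_passage.

(** * Increments of the subordinator between two passages *)

Section tails.
Context d (T : measurableType d) {R : realType} (P : probability T R).

(** Both expectations are integrals of tails, which turns product formulas for events into product
    formulas for integrals. *)
Lemma ge0_integral_tail (A : set T) (f g : T -> R) (c : R) :
  measurable A -> measurable_fun [set: T] f -> measurable_fun [set: T] g ->
  (forall x, 0 <= f x) -> (forall x, 0 <= g x) -> 0 <= c ->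
  (forall r : R, 0 <= r ->
    P (A `&` [set x | r < f x]) = (c%:E * P [set x | (r < g x)%R])%E) ->
  (\int[P]_(x in A) (f x)%:E = c%:E * \int[P]_x (g x)%:E)%E.
Proof.
move=> mA mf mg f0 g0 c0 tail.
have mX : measurable_fun [set: T] (fun x => \1_A x * f x).
  by apply: measurable_funM => //; exact: measurable_indic.
pose X : {RV P >-> R} := HB.pack (fun x => \1_A x * f x)
  (isMeasurableFun.Build _ _ _ _ _ mX).
pose Z : {RV P >-> R} := HB.pack g (isMeasurableFun.Build _ _ _ _ _ mg).
have X0 x : 0 <= X x by rewrite mulr_ge0// indicE ler0n.
have -> : (\int[P]_(x in A) (f x)%:E = 'E_P[X])%E.
  rewrite unlock integral_mkcond; apply: eq_integral => x _.
  by rewrite patchE /X/= indicE; case: (x \in A); rewrite ?mul1r ?mul0r.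
have -> : (\int[P]_x (g x)%:E = 'E_P[Z])%E by rewrite unlock.
rewrite !ge0_expectation_ccdf// -ge0_integralZl_EFin//; last first.
  by apply: measurable_funTS; exact: ccdf_measurable.
apply: eq_integral => r; rewrite inE/= in_itv/= andbT => r0.
rewrite /ccdf /distribution /pushforward.
transitivity (P (A `&` [set x | r < f x])).
  congr (P _); apply/seteqP; split => x /=; rewrite in_itv/= andbT indicE.
    have [xA|xA] := boolP (x \in A); last by rewrite mul0r ltNge r0.
    by rewrite mul1r; move: xA; rewrite inE.
  by case=> Ax rf; rewrite mem_set// mul1r.
by rewrite tail//; congr (_ * P _)%E; apply/seteqP; split => x /=; rewrite in_itv/= andbT.
Qed.

Lemma ge0_eq_integral_nat (N : T -> nat) (A : set T) (f g : T -> \bar R) :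
  measurable A -> measurable_fun [set: T] N ->
  measurable_fun [set: T] f -> measurable_fun [set: T] g ->
  (forall x, (0 <= f x)%E) -> (forall x, (0 <= g x)%E) ->
  (forall j, \int[P]_(x in A `&` [set x | N x = j]) f x =
    \int[P]_(x in A `&` [set x | N x = j]) g x)%E ->
  (\int[P]_(x in A) f x = \int[P]_(x in A) g x)%E.
Proof.
move=> mA mN mf mg f0 g0 fg; pose F j := A `&` [set x | N x = j].
have mF j : measurable (F j) by apply: measurableI => //; exact: measurable_nat_eq.
have tF : trivIset setT F.
  by move=> i j _ _ [x [[_ <-] [_ <-]]].
have AE : A = \bigcup_j F j.
  by apply/seteqP; split => [x Ax|x [j _ []]//]; exists (N x).
rewrite AE !ge0_integral_bigcup//; do ?exact: measurable_funTS.
by apply: eq_eseriesr => j _; exact: fg.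
Qed.

Lemma measurable_fun_nat_index d' (E : measurableType d') (F : nat -> T -> E)
    (N : T -> nat) : (forall j, measurable_fun [set: T] (F j)) ->
  measurable_fun [set: T] N -> measurable_fun [set: T] (fun x => F (N x) x).
Proof.
move=> mF mN _ Y mY; rewrite setTI.
rewrite (_ : _ @^-1` Y = \bigcup_j ([set x | N x = j] `&` F j @^-1` Y)).
  apply: bigcup_measurable => j _; apply: measurableI; first exact: measurable_nat_eq.
  by rewrite -[X in measurable X]setTI; exact: mF.
by apply/seteqP; split => [x Yx|x [j _ [/= <-]]//]; exists (N x).
Qed.

Lemma cvg_integral_expR (theta : R) (f_ : nat -> T -> R) (f : T -> R) :
  0 <= theta -> (forall n, measurable_fun [set: T] (f_ n)) ->
  measurable_fun [set: T] f ->
  {ae P, forall x, forall n, 0 <= f_ n x} ->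
  {ae P, forall x, f_ ^~ x @ \oo --> f x} ->
  (\int[P]_x (expR (- (theta * f_ n x)))%:E @[n --> \oo] -->
   \int[P]_x (expR (- (theta * f x)))%:E)%E.
Proof.
move=> th0 mf_ mf f0 ff.
have mE h : measurable_fun [set: T] h ->
    measurable_fun [set: T] (fun x => (expR (- (theta * h x)))%:E).
  move=> mh; apply/measurable_EFinP; apply: measurableT_comp => //.
  by apply: measurableT_comp => //; exact: measurable_funM.
have [|||_ _] := @dominated_convergence _ T R P setT measurableT
  (fun n x => (expR (- (theta * f_ n x)))%:E) (fun x => (expR (- (theta * f x)))%:E)
  (cst 1%E) (fun n => mE _ (mf_ n)) (mE _ mf).
- apply: filterS ff => x cx _.
  have c : expR (- (theta * f_ n x)) @[n --> \oo] --> expR (- (theta * f x)).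
    apply: continuous_cvg; first exact: continuous_expR.
    by apply: cvgN; apply: cvgMr.
  by apply: cvg_EFin; [exact: nearW|exact: c].
- exact: finite_measure_integrable_cst.
- apply: filterS f0 => x h n _ /=; rewrite lee_fin ger0_norm ?expR_ge0//.
  by rewrite -expR0 ler_expR oppr_le0 mulr_ge0.
exact.
Qed.

End tails.

Section passage_index_events.
Context {R : realType} d (T : measurableType d).
Implicit Types (M : R -> T -> nat).
Local Notation G M := (process_sigma_algebra `[0, +oo[%classic M).

(** Independence of [S] is stated for the sigma-algebra of [M], so the indices must be events of
    that sigma-algebra and not merely measurable. *)
Lemma process_sigma_passage_index M c N j :
  G M [set w | passage_index (M ^~ w) c N = j].
Proof.
have cyl i (Y : set nat) : G M (M (dyadic N i) @^-1` Y).
  by apply: process_sigma_cylinder => //=; rewrite in_itv/= dyadic_ge0.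
pose E l w := (M (dyadic N l.+1) w <= c)%N /\
  forall i, (i < l)%N -> (c < M (dyadic N i.+1) w)%N.
have sE l : G M (E l).
  rewrite (_ : E l = (M (dyadic N l.+1) @^-1` [set n | (n <= c)%N]) `&`
    \bigcap_(i in [set i | (i < l)%N]) (M (dyadic N i.+1) @^-1` [set n | (c < n)%N])).
    apply: process_sigmaI; first exact: cyl.
    by apply: process_sigma_bigcap => i _; exact: cyl.
  by apply/seteqP; split => w [].
have sN : G M (\bigcap_l ~` E l).
  by apply: process_sigma_bigcap => l _; exact: process_sigmaC.
have E_inj w l l' : E l w -> E l' w -> l = l'.
  move=> [h1 h2] [h1' h2']; case: (ltngtP l l') => // [/h2'|/h2].
    by rewrite ltnNge h1.
  by rewrite ltnNge h1'.
have idxE w l : E l w -> passage_index (M ^~ w) c N = l.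
  move=> El; apply: (E_inj w) (El).
  exact: (@getI _ [set j | E j w] l).
have idxN w : (forall l, ~ E l w) -> passage_index (M ^~ w) c N = point.
  by move=> h; apply: getPN.
(* [get] returns [point] when no index qualifies, so this level set alone also contains the paths
   without an index. *)
have [->|nj] := eqVneq j point.
  rewrite (_ : [set w | _] = ~` (~` E point `&` ~` \bigcap_l ~` E l)).
    apply: process_sigmaC; apply: process_sigmaI; exact: process_sigmaC.
  rewrite setCI !setCK; apply/seteqP; split => w /=.
    have [[l El] <-|nE _] := pselect (exists l, E l w).
      by left; rewrite (idxE _ _ El).
    by right => l _ El; apply: nE; exists l.
  by case=> [/idxE//|h]; apply: idxN => l; exact: h.
rewrite (_ : [set w | _] = E j)//; apply/seteqP; split => w /=; last exact: idxE.
have [[l El]|nE] := pselect (exists l, E l w).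
  by rewrite (idxE _ _ El) => <-.
by rewrite idxN => [h|l El]; [rewrite h eqxx in nj|apply: nE; exists l].
Qed.

Lemma process_sigma_measurable M (A : set T) :
  (forall t, 0 <= t -> measurable_fun [set: T] (M t)) -> G M A -> measurable A.
Proof.
move=> mM; apply; split; first exact: sigma_algebra_measurable.
move=> B [t /=]; rewrite in_itv/= andbT => t0 [Y mY <-].
exact: mM.
Qed.

End passage_index_events.

Section increments.
Context {R : realType} d (T : measurableType d) (P : probability T R).
Variables (nu : R) (M : R -> T -> nat) (S : R -> T -> R).
Local Notation GM := (process_sigma_algebra `[0, +oo[%classic M).
Hypothesis mM : forall t : R, 0 <= t -> measurable_fun [set: T] (M t).

(** For each tail event, independence splits off [P A] and stationarity replaces the increment by
    [S t]. *)
Lemma stable_increment_laplace (A : set T) (s t w : R) :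
  stable_subordinator P nu S ->
  independent_systems P GM (process_sigma_algebra `[0, +oo[%classic S) ->
  GM A -> 0 <= s -> 0 <= t -> 0 < w ->
  (\int[P]_(o in A) (expR (- (w * (S (s + t) o - S s o))))%:E =
   P A * (expR (- (w `^ nu * t)))%:E)%E.
Proof.
move=> [[mS _ stat _] lap] indep GA s0 t0 w0.
have mA : measurable A by exact: process_sigma_measurable GA.
have st0 : 0 <= s + t by rewrite addr_ge0.
have mE (U : T -> R) : measurable_fun [set: T] U ->
    measurable_fun [set: T] (fun o => expR (- (w * U o))).
  move=> mU; apply: measurableT_comp => //.
  by apply: measurableT_comp => //; exact: measurable_funM.
rewrite (@ge0_integral_tail _ _ _ _ _ _ (fun o => expR (- (w * S t o))) (fine (P A)))//.
- rewrite fineK ?fin_num_measure//; congr (_ * _)%E.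
  have := lap _ _ (ltW w0) t0; rewrite unlock mulrC mulrN => <-.
  by apply: eq_integral => o _; rewrite mulNr.
- by apply: mE; apply: measurable_funB; exact: mS.
- by apply: mE; exact: mS.
- exact: fine_ge0.
move=> r r0; rewrite fineK ?fin_num_measure//.
pose B : set R := [set u | r < expR (- (w * u))].
have mB : measurable B.
  have me : measurable_fun [set: R] (fun u : R => expR (- (w * u))).
    by apply: measurableT_comp => //; apply: measurableT_comp => //; exact: measurable_funM.
  rewrite -[B]setTI (_ : B = (fun u => expR (- (w * u))) @^-1` `]r, +oo[%classic).
    by apply: me => //; exact: measurable_itv.
  by apply/seteqP; split => u /=; rewrite in_itv/= andbT.
have mU : process_sigma_algebra `[0, +oo[%classic S [set o | B (S (s + t) o - S s o)].
  pose TG := g_sigma_algebraType (\bigcup_(x in `[0, +oo[%classic)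
    preimage_set_system [set: T] (S x) measurable).
  have mS' x : 0 <= x -> measurable_fun [set: TG] (S x : TG -> R).
    move=> x0 _ Y mY; rewrite setTI; apply: process_sigma_cylinder => //=.
    by rewrite in_itv/= x0.
  have := measurable_funB (mS' _ st0) (mS' _ s0).
  by move=> /(_ measurableT B mB); rewrite setTI.
transitivity (P (A `&` [set o | B (S (s + t) o - S s o)])) => //.
by rewrite (indep _ _ GA mU) (stat s t B s0 t0 mB).
Qed.

Hypothesis mS : forall x : R, 0 <= x -> measurable_fun [set: T] (S x).
(** Satisfied by a stable subordinator independent of [M] and, if [nu = 1], by the identity. *)
Hypothesis increment_laplace : forall (A : set T) (s t w : R),
  GM A -> 0 <= s -> 0 <= t -> 0 < w ->
  (\int[P]_(o in A) (expR (- (w * (S (s + t) o - S s o))))%:E =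
   P A * (expR (- (w `^ nu * t)))%:E)%E.

(** On the event that both indices are given, which belongs to [GM], the two times are constants and
    [increment_laplace] applies; indices in the wrong order form a null event. *)
Lemma laplace_increment_at (tau : nat -> R) (N N' : T -> nat) (w : R) :
  0 < w -> (forall j, 0 <= tau j) -> {homo tau : i j / (i <= j)%N >-> i <= j} ->
  (forall j, GM [set o | N o = j]) -> (forall j, GM [set o | N' o = j]) ->
  {ae P, forall o, (N o <= N' o)%N} ->
  (\int[P]_o (expR (- (w * (S (tau (N' o)) o - S (tau (N o)) o))))%:E =
   \int[P]_o (expR (- (w `^ nu * (tau (N' o) - tau (N o)))))%:E)%E.
Proof.
move=> w0 tau0 ndtau GN GN' NN'.
have mN : measurable_fun [set: T] N.
  by apply: measurable_fun_nat => j; exact: process_sigma_measurable (GN j).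
have mN' : measurable_fun [set: T] N'.
  by apply: measurable_fun_nat => j; exact: process_sigma_measurable (GN' j).
have mE (v : R) (U : T -> R) : measurable_fun [set: T] U ->
    measurable_fun [set: T] (fun o => (expR (- (v * U o)))%:E).
  move=> mU; apply/measurable_EFinP; apply: measurableT_comp => //.
  by apply: measurableT_comp => //; exact: measurable_funM.
have mf : measurable_fun [set: T]
    (fun o => (expR (- (w * (S (tau (N' o)) o - S (tau (N o)) o))))%:E).
  apply: mE; apply: measurable_funB;
    by apply: (@measurable_fun_nat_index _ _ _ _ (fun j => S (tau j))) => // j; exact: mS.
have mg : measurable_fun [set: T]
    (fun o => (expR (- (w `^ nu * (tau (N' o) - tau (N o)))))%:E).
  apply: mE; apply: measurable_funB;
    by apply: (@measurable_fun_nat_index _ _ _ _ (fun j _ => tau j)).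
apply: (ge0_eq_integral_nat (N := N)) => //= j.
have mj : measurable (setT `&` [set x | N x = j]).
  by apply: measurableI => //; exact: measurable_nat_eq.
apply: (ge0_eq_integral_nat (N := N')) => //= j'.
rewrite setTI; set B := _ `&` _.
have GB : GM B by exact: process_sigmaI.
have mB : measurable B by exact: process_sigma_measurable GB.
have [jj'|jj'] := leqP j j'.
  transitivity (\int[P]_(o in B) (expR (- (w * (S (tau j + (tau j' - tau j)) o -
      S (tau j) o))))%:E)%E.
    by apply: eq_integral => o; rewrite inE [tau j + _]addrC subrK => -[/= -> ->].
  rewrite increment_laplace ?subr_ge0 ?ndtau//.
  rewrite muleC -integral_cst//; apply: eq_integral => o.
  by rewrite inE => -[/= -> ->].
have PB : P B = 0%E.
  rewrite -(@measure0 _ _ _ P); apply: ae_eq_measure => //.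
  by apply: filterS NN' => o h; split => // -[/= e1 e2]; move: h; rewrite e1 e2 leqNgt jj'.
by rewrite !null_set_integral//; exact: measurable_funTS.
Qed.

End increments.

Section inverse_of_identity.
Context {R : realType} (T : Type).

Lemma inverse_process_id (t : R) (w : T) : 0 <= t ->
  inverse_process (fun x _ => x) t w = t.
Proof.
move=> t0; apply/eqP; rewrite eq_le; apply/andP; split.
  apply/ler_addgt0Pr => e e0; apply: ge_inf; first by exists 0 => x [].
  by split; [rewrite addr_ge0// ltW|rewrite ltrDl].
apply: lb_le_inf => [|x [_ /ltW]//].
by exists (t + 1); split; [rewrite addr_ge0|rewrite ltrDl].
Qed.

End inverse_of_identity.

Section unbounded_paths.
Context {R : realType} d (T : measurableType d) (P : probability T R).

(** Markov's inequality for [expR (- S n)], of expectation [expR (- n)], bounds [P (S n <= K)] by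
    [expR (K - n)]. *)
Lemma stable_subordinator_unbounded (nu : R) (S : R -> T -> R) :
  stable_subordinator P nu S ->
  {ae P, forall w, forall K, exists2 x, 0 <= x & K < S x w}.
Proof.
move=> [[mS _ _ _] lap].
pose B (K n : nat) := [set w | S n%:R w <= K%:R].
have mB K n : measurable (B K n).
  rewrite -[B K n]setTI (_ : B K n = S n%:R @^-1` `]-oo, K%:R]%classic).
    by apply: mS => //; exact: measurable_itv.
  by apply/seteqP; split => w /=; rewrite in_itv.
have PB K n : (P (B K n) <= (expR (K%:R - n%:R))%:E)%E.
  have -> : (expR (K%:R - n%:R))%:E =
      (\int[P]_w ((expR K%:R)%:E * (expR (-1 * S n%:R w))%:E))%E.
    rewrite ge0_integralZl_EFin ?expR_ge0//; last first.
      apply/measurable_EFinP; apply: measurableT_comp => //.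
      by apply: measurable_funM => //; exact: mS.
    have := lap 1 n%:R ler01 (ler0n _ _); rewrite unlock => ->.
    by rewrite powR1 mulr1 -EFinM -expRD.
  rewrite -[leLHS]mul1e -integral_cst//=.
  apply: le_trans (_ : (\int[P]_(w in B K n) ((expR K%:R)%:E * (expR (-1 * S n%:R w))%:E) <= _)%E).
    apply: ge0_le_integral => //.
    - apply: measurable_funTS; apply: emeasurable_funM => //.
      apply/measurable_EFinP; apply: measurableT_comp => //.
      by apply: measurable_funM => //; exact: mS.
    - by move=> w /= h; rewrite -EFinM lee_fin -expRD mulN1r -[leLHS]expR0 ler_expR subr_ge0.
  apply: ge0_subset_integral => //.
  apply: emeasurable_funM => //.
  apply/measurable_EFinP; apply: measurableT_comp => //.
  by apply: measurable_funM => //; exact: mS.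
have ub : {ae P, forall w, forall K : nat, exists n : nat, K%:R < S n%:R w}.
  apply/ae_foralln => K; exists (\bigcap_n B K n); split.
  - exact: bigcapT_measurable.
  - apply/eqP; rewrite -measure_le0; apply/lee_addgt0Pr => e e0; rewrite add0e.
    pose n := Num.bound `|K%:R - ln e|.
    apply: (@le_trans _ _ (P (B K n))).
      by apply: le_measure; rewrite ?inE//; [exact: bigcapT_measurable|exact: bigcap_inf].
    apply: le_trans (PB K n) _; rewrite lee_fin -[leRHS]lnK ?posrE// ler_expR.
    by rewrite lerBlDl -lerBlDr ltW// (le_lt_trans (ler_norm _))// archi_boundP.
  - by move=> w /= hw n _; rewrite /B/= leNgt; apply/negP => h; apply: hw; exists n.
apply: filterS ub => w h K; have [n hn] := h (Num.bound `|K|); exists n%:R => //.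
by apply: le_lt_trans hn; rewrite (le_trans (ler_norm _))// ltW// archi_boundP.
Qed.

End unbounded_paths.

(** * Interdeath times of the time-changed process *)

Section time_changed_death_process.
Context {R : realType} d (T : measurableType d) (P : probability T R).
Variables (nu mu : R) (n0 : nat) (M : R -> T -> nat) (S : R -> T -> R).
Variable X : R -> T -> nat.
Local Notation GM := (process_sigma_algebra `[0, +oo[%classic M).
Hypotheses (nu0 : 0 < nu) (mu0 : 0 < mu) (hM : sublinear_death_process P mu n0 M).
Hypotheses (mS : forall x : R, 0 <= x -> measurable_fun [set: T] (S x))
  (S0 : forall w, S 0 w = 0)
  (ndS : forall w (s t : R), 0 <= s -> s <= t -> S s w <= S t w)
  (unbS : {ae P, forall w, forall K, exists2 x, 0 <= x & K < S x w}).
Hypothesis increment_laplace : forall (A : set T) (s t w : R),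
  GM A -> 0 <= s -> 0 <= t -> 0 < w ->
  (\int[P]_(o in A) (expR (- (w * (S (s + t) o - S s o))))%:E =
   P A * (expR (- (w `^ nu * t)))%:E)%E.
Hypothesis XE : forall (t : R) w, 0 <= t -> X t w = M (inverse_process S t w) w.
Variable k : nat.
Hypothesis kn : (k < n0)%N.

Let idx j N w := passage_index (M ^~ w) (n0 - j) N.
Let sigma j w : R := first_passage (M ^~ w) (n0 - j).
Let Y w := interdeath_time n0 X k w.
(** A real version of [Y], truncated at 0 because nonnegativity is wanted on every path, whereas
    monotone paths are only almost sure; the same holds for [z]. *)
Let y w := Num.max 0 (fine (Y w)).
Let z w := Num.max 0 (sigma k.+1 w - sigma k w).
Let gap N w := dyadic N (idx k.+1 N w) - dyadic N (idx k N w) : R.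
Let Sgap N w := S (dyadic N (idx k.+1 N w)) w - S (dyadic N (idx k N w)) w.

Let mX t : 0 <= t -> measurable_fun [set: T] (X t).
Proof.
move=> t0; rewrite (_ : X t = fun w => M (inverse_process S t w) w).
  apply: measurable_process_at.
  - exact: (death_measurable hM).
  - exact: (death_right_constant hM).
  - exact: measurable_inverse_process.
  - by move=> w; exact: inverse_process_ge0.
by apply/funext => w; exact: XE.
Qed.

Let rX w : right_constant (X ^~ w).
Proof.
move=> t t0; have [e e0 h] := right_constant_time_change S (death_right_constant hM w) t0.
exists e => // s ts se; rewrite XE ?(le_trans t0)// XE//; exact: h.
Qed.

Let mY : measurable_fun [set: T] Y.
Proof. by apply: emeasurable_funB; exact: measurable_death_time. Qed.

Let my : measurable_fun [set: T] y.
Proof. by apply: measurable_maxr => //; exact: measurableT_comp. Qed.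

Let msigma j : measurable_fun [set: T] (sigma j).
Proof.
apply: measurable_first_passage; first exact: (death_measurable hM).
exact: (death_right_constant hM).
Qed.

Let mz : measurable_fun [set: T] z.
Proof. by apply: measurable_maxr => //; exact: measurable_funB. Qed.

Let Gidx j N i : GM [set w | idx j N w = i].
Proof. exact: process_sigma_passage_index. Qed.

Let midx j N : measurable_fun [set: T] (idx j N).
Proof.
apply: measurable_fun_nat => i.
exact: process_sigma_measurable (death_measurable hM) (Gidx j N i).
Qed.

Let mgap N : measurable_fun [set: T] (gap N).
Proof.
apply: measurable_funB;
  by apply: (@measurable_fun_nat_index _ _ _ _ (fun j _ => dyadic N j : R)).
Qed.

Let mSgap N : measurable_fun [set: T] (Sgap N).
Proof.
apply: measurable_funB;
  apply: (@measurable_fun_nat_index _ _ _ _ (fun j => S (dyadic N j))) => // j;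
  by apply: mS; exact: dyadic_ge0.
Qed.

Let idx_le : {ae P, forall w, forall N, (idx k N w <= idx k.+1 N w)%N}.
Proof.
apply: filterS2 (death_nonincreasing hM) (death_reaches mu0 hM) => w dm reach N.
by apply: passage_index_anti => //; exact: leq_sub2l.
Qed.

Let gap_ge0 : {ae P, forall w, forall N, 0 <= gap N w}.
Proof. by apply: filterS idx_le => w h N; rewrite subr_ge0 le_dyadic. Qed.

Let Sgap_ge0 : {ae P, forall w, forall N, 0 <= Sgap N w}.
Proof.
apply: filterS idx_le => w h N; rewrite subr_ge0; apply: ndS; first exact: dyadic_ge0.
exact: le_dyadic.
Qed.

Let cvg_gap : {ae P, forall w, gap ^~ w @ \oo --> z w}.
Proof.
apply: filterS3 (death_nonincreasing hM) (death_reaches mu0 hM) gap_ge0 => w dm reach g0.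
have c : gap ^~ w @ \oo --> sigma k.+1 w - sigma k w.
  by apply: cvgB; apply: cvg_passage_dyadic => //; exact: (death_right_constant hM).
rewrite /z max_r//; apply: (ler_cvg_to (cvg_cst 0) c); exact: nearW.
Qed.

Let cvg_Sgap : {ae P, forall w, Y w = (y w)%:E /\ Sgap ^~ w @ \oo --> y w}.
Proof.
have good : {ae P, forall w,
    (forall s t : R, 0 <= s -> s <= t -> (M t w <= M s w)%N) /\
    (forall c, exists2 s : R, 0 <= s & (M s w <= c)%N)}.
  by apply: filterS2 (death_nonincreasing hM) (death_reaches mu0 hM) => w.
apply: filterS3 good unbS Sgap_ge0 => w [dm reach] unb g0.
have dt j := @death_time_time_change _ _ _ _ _ w (death_right_constant hM w) dm
  (fun t => death_le hM w) reach (S0 w) (ndS w) unb X (fun t => XE w) j.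
have [t1 e1 c1] := dt k.+1 kn; have [t0 e0 c0] := dt k (ltnW kn).
have c : Sgap ^~ w @ \oo --> t1 - t0 by exact: cvgB.
have t10 : 0 <= t1 - t0 by apply: (ler_cvg_to (cvg_cst 0) c); exact: nearW.
have YE : Y w = (t1 - t0)%:E by rewrite /Y /interdeath_time e1 e0.
by rewrite /y YE max_r.
Qed.

Let laplace_z theta : 0 < theta ->
  (\int[P]_w (expR (- (theta * z w)))%:E =
   (mu * k.+1%:R / (mu * k.+1%:R + theta))%:E)%E.
Proof.
move=> th0; apply: exponential_laplace => //; first by rewrite mulr_gt0.
  by move=> w; rewrite le_max lexx.
move=> u u0; pose c := (n0 - k.+1)%N.
have E : [set w | u < z w] =
    [set w | first_passage (M ^~ w) c.+1 + u < first_passage (M ^~ w) c].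
  apply/seteqP; split => w /=; rewrite /z /sigma (_ : (n0 - k)%N = c.+1); try by rewrite /c; lia.
    by rewrite lt_max ltNge u0/= ltrBrDl.
  by rewrite lt_max ltrBrDl orbC => ->.
rewrite E (P_sojourn_gt mu0 hM)//.
- by rewrite (_ : (n0 - c)%N = k.+1)// /c; lia.
- by rewrite /c; lia.
rewrite -E -[X in measurable X]setTI.
have -> : [set w | u < z w] = z @^-1` `]u, +oo[%classic.
  by apply/seteqP; split => w /=; rewrite in_itv/= andbT.
by apply: mz => //; exact: measurable_itv.
Qed.

(* Conditionally on [M], the increment of [S] over the gap has Laplace transform
   [expR (- w `^ nu * gap)]; letting the dyadic level grow transfers this to
   [y], hence the Laplace transform of [y] at [w] is that of [z] at [w `^ nu]. *)
Let laplace_y w : 0 < w ->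
  (\int[P]_o (expR (- (w * y o)))%:E =
   (mu * k.+1%:R / (mu * k.+1%:R + w `^ nu))%:E)%E.
Proof.
move=> w0; rewrite -laplace_z ?powR_gt0//.
have cS : {ae P, forall o, Sgap ^~ o @ \oo --> y o} by apply: filterS cvg_Sgap => o [].
have h1 := cvg_integral_expR (ltW w0) mSgap my Sgap_ge0 cS.
have h2 := cvg_integral_expR (powR_ge0 w nu) mgap mz gap_ge0 cvg_gap.
have E : (fun n => \int[P]_o (expR (- (w * Sgap n o)))%:E)%E =
    (fun n => \int[P]_o (expR (- (w `^ nu * gap n o)))%:E)%E.
  apply/funext => n; apply: (@laplace_increment_at _ _ _ P nu M S) => //.
  - exact: (death_measurable hM).
  - by move=> j; exact: dyadic_ge0.
  - by move=> i j; exact: le_dyadic.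
  - by apply: filterS idx_le => o.
move: h1; rewrite E => h1; exact: (cvg_unique (@ereal_hausdorff R) h1 h2).
Qed.

Lemma has_pdf_interdeath_time :
  has_pdf P (interdeath_time n0 X k) (ml_density nu (mu * k.+1%:R)).
Proof.
apply: (@has_pdf_ml_density _ _ _ P nu (mu * k.+1%:R) nu0 _ Y y) => //.
- by rewrite mulr_gt0.
- by move=> w; rewrite le_max lexx.
- by apply: filterS cvg_Sgap => w [].
Qed.

End time_changed_death_process.

Theorem theorem2p2 (R : realType) (d : measure_display) (T : measurableType d)
  (P : probability T R) (nu mu : R) (n0 : nat) (X : R -> T -> nat)
  (hnu0 : 0 < nu) (hnu1 : nu <= 1) (hmu : 0 < mu) (hn0 : (1 <= n0)%N)
  (hX : fractional_sublinear_death_process P nu mu n0 X)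
  (k : nat) (hk : (k < n0)%N) :
  has_pdf P (interdeath_time n0 X k)
    (fun t : R =>
       if 0 < t then
         mu * k.+1%:R * t `^ (nu - 1) *
         mittag_leffler nu nu (- (mu * k.+1%:R) * t `^ nu)
       else 0).
Proof.
case: hX => M hM; have mM := death_measurable hM; have [nu1 XM|_ [S [hS indep XE]]] := eqVneq nu 1.
  apply: (@has_pdf_interdeath_time _ _ _ P nu mu n0 M (fun x _ => x) X) => //.
  - by apply: aeW => w K; exists (`|K| + 1); rewrite ?addr_ge0// (le_lt_trans (ler_norm _))// ltrDl.
  - move=> A s t w GA s0 t0 w0; rewrite nu1 powRr1 ?(ltW w0)// [s + t]addrC addrK.
    by rewrite muleC integral_cst//; exact: process_sigma_measurable GA.
  - by move=> t w t0; rewrite inverse_process_id// XM.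
have [[mS [S0 ndS _] _ _] _] := hS.
apply: (@has_pdf_interdeath_time _ _ _ P nu mu n0 M S X) => //.
- exact: stable_subordinator_unbounded hS.
- by move=> A s t w GA; exact: (stable_increment_laplace mM hS indep GA).
Qed.
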